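(* There is an algorithm that, given a finite-state automaton $\mathcal{S}=(X,T,X_0,\to,\Sigma,\ell)$ and $K\in\mathbb{N}$, decides in polynomial time (polynomial in the size of $\mathcal{S}$ and in $K$) whether $\mathcal{S}$ is $\omega$-$K$-delayed strongly detectable.
   Context: A finite-state automaton (FSA) is a sextuple $\mathcal{S}=(X,T,X_0,\to,\Sigma,\ell)$, where $X$ is a finite set of states, $T$ a finite set of events, $X_0\subset X$ a set of initial states, $\to\subset X\times T\times X$ a transition relation, $\Sigma$ a finite set of labels, and $\ell:T\to\Sigma\cup\{\epsilon\}$ a labeling function ($\epsilon$ is the empty word). No further assumption (deadlock-freeness, absence of unobservable cycles, etc.) is made. $\ell$ is extended to finite and infinite event sequences by $\ell(t_1t_2\dots)=\ell(t_1)\ell(t_2)\dots$, $\ell(\epsilon)=\epsilon$. For $s=t_1\cdots t_n\in T^*$, $x\xrightarrow{s}x'$ means that there are states $x=x_0,x_1,\dots,x_n=x'$ with $(x_{i-1},t_i,x_i)\in\to$ for all $i$ (so $x\xrightarrow{\epsilon}x$). The size of $\mathcal{S}$ is e.g. $|X|+|T|+|\Sigma|+|\to|$. For $\sigma_1,\sigma_2\in\Sigma^*$ define the delayed state estimate $$\mathcal{M}(\mathcal{S},\sigma_1,\sigma_2)=\{x\in X\mid \exists x_0\in X_0,\ \exists x'\in X,\ \exists s_1,s_2\in T^*:\ \ell(s_1)=\sigma_1,\ \ell(s_2)=\sigma_2,\ x_0\xrightarrow{s_1}x\xrightarrow{s_2}x'\}.$$ The $\omega$-language $\mathcal{L}^\omega(\mathcal{S})$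 is the set of $\sigma\in\Sigma^\omega$ (infinite words) such that $\sigma=\ell(t_1t_2\dots)$ for some infinite event sequence $t_1t_2\dots\in T^\omega$ for which there are states $x_0,x_1,\dots$ with $x_0\in X_0$ and $(x_i,t_{i+1},x_{i+1})\in\to$ for all $i\in\mathbb{N}$. Write $\sigma'\sqsubset\sigma$ if the finite word $\sigma'$ is a prefix of $\sigma$. $\mathcal{S}$ is $\omega$-$K$-delayed strongly detectable if there is $k\in\mathbb{N}$ such that for all $\sigma\in\mathcal{L}^\omega(\mathcal{S})$ and all $\sigma_1,\sigma_2\in\Sigma^*$ with $\sigma_1\sigma_2\sqsubset\sigma$: if $|\sigma_1|\ge k$ and $|\sigma_2|\ge K$, then $|\mathcal{M}(\mathcal{S},\sigma_1,\sigma_2)|=1$. *)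

(* Defs.v *)
From mathcomp Require Import all_boot all_algebra.
From mathcomp Require Import boolp.

Set Implicit Arguments.
Unset Strict Implicit.
Unset Printing Implicit Defensive.

(** * Finite-state automata *)

(* [label t = None] means that the event [t] is unobservable (its label is the
   empty word). *)
Record fsa := FSA {
  state : finType;
  event : finType;
  init : {set state};
  trans : {set state * event * state};
  letter : finType;
  label : event -> option letter
}.

Definition fsa_size (A : fsa) : nat :=
  #|state A| + #|event A| + #|letter A| + #|trans A|.

Definition label_word (A : fsa) (s : seq (event A)) : seq (letter A) :=
  pmap (@label A) s.

Fixpoint run_word (A : fsa) (x : state A) (s : seq (event A)) (x' : state A)
    : Prop :=
  if s is t :: s1 then
    exists2 y, (x, t, y) \in trans A & run_word y s1 x'
  else x = x'.

Definition delayed_estimate (A : fsa) (w1 w2 : seq (letter A))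
    : {set state A} :=
  [set x | `[< exists (x0 x' : state A) (s1 s2 : seq (event A)),
      [/\ x0 \in init A, label_word s1 = w1, label_word s2 = w2,
          run_word x0 s1 x & run_word x s2 x'] >]].

(* Infinite words over [S] are functions [nat -> S], with 0-based indices. *)
Definition prefix_of (S : Type) (w : seq S) (sigma : nat -> S) : Prop :=
  w = mkseq sigma (size w).

(* The possibly finite word [l(t_0 t_1 ...)] is the infinite word [sigma]: the
   labels of the finite prefixes of [t] are prefixes of [sigma] of unbounded
   length. *)
Definition label_omega (A : fsa) (t : nat -> event A) (sigma : nat -> letter A)
    : Prop :=
  (forall n, prefix_of (label_word (mkseq t n)) sigma) /\
  (forall m, exists n, m <= size (label_word (mkseq t n))).

Definition omega_language (A : fsa) (sigma : nat -> letter A) : Prop :=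
  exists (t : nat -> event A) (x : nat -> state A),
    [/\ x 0 \in init A,
        forall i, (x i, t i, x i.+1) \in trans A
      & label_omega t sigma].

Definition omega_delayed_strongly_detectable (A : fsa) (K : nat) : Prop :=
  exists k : nat, forall sigma : nat -> letter A, omega_language sigma ->
    forall w1 w2 : seq (letter A), prefix_of (w1 ++ w2) sigma ->
      k <= size w1 -> K <= size w2 -> #|delayed_estimate w1 w2| = 1.

(** * Random access machines

   Algorithms are programs of a random access machine in the style of Cook and
   Reckhow (1973): countably many registers holding natural numbers, initially
   0, indirect addressing, and a sequential read-only input.  Every instruction
   costs one time unit.  Since addition and (truncated) subtraction are the only
   arithmetic operations, the bit length of register contents grows by at most
   one per step, and unit-cost polynomial time is the same as polynomial time on
   Turing machines. *)

Inductive instr :=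
| Const of nat & nat         (* Const r n    : R[r] := n                      *)
| Add of nat & nat & nat     (* Add r a b    : R[r] := R[a] + R[b]            *)
| Sub of nat & nat & nat     (* Sub r a b    : R[r] := R[a] - R[b]            *)
| Fetch of nat & nat         (* Fetch r a    : R[r] := R[R[a]]                *)
| Store of nat & nat         (* Store a r    : R[R[a]] := R[r]                *)
| Read of nat                (* Read r       : R[r] := next input number, or  *)
                             (*                0 once the input is exhausted  *)
| JumpZ of nat & nat         (* JumpZ r l    : go to l if R[r] = 0            *)
| Halt of bool.              (* Halt b       : stop with answer b             *)

Definition program := seq instr.

Record config := Config {
  counter : nat;
  regs : nat -> nat;
  input : seq nat
}.

Definition start (w : seq nat) : config := Config 0 (fun=> 0) w.

Definition exec (i : instr) (c : config) : config :=
  let: Config pc R w := c in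
  match i with
  | Const r n => Config pc.+1 [eta R with r |-> n] w
  | Add r a b => Config pc.+1 [eta R with r |-> R a + R b] w
  | Sub r a b => Config pc.+1 [eta R with r |-> R a - R b] w
  | Fetch r a => Config pc.+1 [eta R with r |-> R (R a)] w
  | Store a r => Config pc.+1 [eta R with R a |-> R r] w
  | Read r => Config pc.+1 [eta R with r |-> head 0 w] (behead w)
  | JumpZ r l => Config (if R r == 0 then l else pc.+1) R w
  | Halt _ => c
  end.

(* [run P n c = Some b] iff [P], started in [c], halts with answer [b] after
   executing at most [n] instructions; leaving the program text gives no
   answer. *)
Fixpoint run (P : program) (n : nat) (c : config) : option bool :=
  if n is n1.+1 then
    match onth P (counter c) with
    | Some (Halt b) => Some b
    | Some i => run P n1 (exec i c)
    | None => None
    end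
  else None.

(** * Presentation of an automaton to a machine

   States, events and letters are numbered by [enum_rank]; sets are listed
   after their cardinals, and the labeling is a table with 0 for the empty word
   and [j.+1] for the letter number [j].  All numbers in the input
   are at most [fsa_size A + K], and there are at most [3 * fsa_size A + 6] of them. *)

Definition code_trans (A : fsa) (e : state A * event A * state A) : seq nat :=
  [:: val (enum_rank e.1.1); val (enum_rank e.1.2); val (enum_rank e.2)].

Definition code_label (A : fsa) (t : event A) : nat :=
  if label t is Some a then (enum_rank a).+1 else 0.

Definition code_instance (A : fsa) (K : nat) : seq nat :=
  [:: #|state A|; #|event A|; #|letter A|; K]
  ++ (#|init A| :: [seq val (enum_rank x) | x <- enum (init A)])
  ++ (#|trans A| :: flatten [seq code_trans e | e <- enum (trans A)])
  ++ [seq code_label t | t <- enum (event A)].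

(* Main.v *)
Require Import Defs.
From mathcomp Require Import all_boot all_algebra zify.
From mathcomp Require Import boolp.

Set Implicit Arguments.
Unset Strict Implicit.
Unset Printing Implicit Defensive.

(* The automaton is not detectable iff for every [k] there are [w1] of length at
   least [k], [w2] of length [K], and three runs on [w1 w2] from initial states,
   the first two of which are in different states after [w1] and the third of
   which can be continued with infinitely many observations.  In the threefold
   synchronized product, whose step [pre] is one observation surrounded by
   silent moves, this says that some initial triple lies in [iter k pre B] for
   every [k], where [B] is the set of the triples from which an ambiguous triple
   can be reached.  As [pre B] is included in [B], these sets decrease with [k]
   and are constant from the number of triples on, so that all the sets involved
   are obtained by polynomially many applications of [pre].

   The algorithm is written in a small language of bounded loops, in which the
   values of the variables (hence the loop bounds) never exceed the numbers in
   the input; this makes the running time of a program a polynomial that is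
   computed from its text. *)

(** * A language of bounded loops and its compiler *)

(** Fourteen arrays, the variables and the scratch registers together fill the 16 residue classes
    into which the compiler divides the registers. *)
Notation array := 'I_14.

Inductive expr :=
| Var of nat
| Cst of nat
| Plus of expr & expr
| Minus of expr & expr
| Get of array & expr
| Sum of nat & nat & expr.

(** No command assigns the value of an expression to a variable: computed values go to arrays, and a
    variable changes only through [Input] or as a loop counter. This is what keeps the loop bounds
    below the size of the input. *)
Inductive cmd :=
| Put of array & expr & expr
| Input of nat
| Seq of cmd & cmd
| For of nat & nat & cmd.

Record store := St {
  vars : nat -> nat;
  arrs : array -> nat -> nat;
  inp : seq nat
}.

Definition setv (s : store) v x := St [eta vars s with v |-> x] (arrs s) (inp s).

Definition seta (s : store) a i x :=
  St (vars s) (fun b j => if (b == a) && (j == i) then x else arrs s b j) (inp s).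

Definition pop (s : store) := St (vars s) (arrs s) (behead (inp s)).

Fixpoint eval (s : store) (e : expr) : nat :=
  match e with
  | Var v => vars s v
  | Cst n => n
  | Plus e1 e2 => eval s e1 + eval s e2
  | Minus e1 e2 => eval s e1 - eval s e2
  | Get a e1 => arrs s a (eval s e1)
  | Sum v b e1 => \sum_(i < vars s b) eval (setv s v i) e1
  end.

(** The bound of a loop is read once, on entry, and the loop variable gets its old value back on
    exit; hence loops around [Put] leave all variables unchanged. *)
Fixpoint sem (c : cmd) (s : store) : store :=
  match c with
  | Put a e1 e2 => seta s a (eval s e1) (eval s e2)
  | Input v => pop (setv s v (head 0 (inp s)))
  | Seq c1 c2 => sem c2 (sem c1 s)
  | For v b c1 =>
      setv (iteri (vars s b) (fun i s1 => sem c1 (setv s1 v i)) s) v (vars s v)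
  end.

(* Registers are shared out modulo 16: residue 0 for the variables, residue 1 for
   the scratch registers, and residue [a + 2] for the array [a]. *)
Definition var v := 16 * v.
Definition tmp i := 16 * i + 1.
Definition cell (a : array) i := 16 * i + a.+2.

Definition store_of (R : nat -> nat) (w : seq nat) :=
  St (fun v => R (var v)) (fun a i => R (cell a i)) w.

(* From [tmp d] on, the scratch registers hold the value of [v] to be restored,
   the bound, the counter, and an intermediate result. *)
Definition loop_code v b d pc (body : nat -> program) : program :=
  let c := body (pc + 9) in
  [:: Const (tmp d) 0; Add (tmp d) (tmp d) (var v);
      Const (tmp d.+1) 0; Add (tmp d.+1) (tmp d.+1) (var b);
      Const (tmp d.+2) 0;
      Defs.Sub (tmp d.+3) (tmp d.+1) (tmp d.+2);
      JumpZ (tmp d.+3) (pc + (size c + 13));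
      Const (var v) 0; Add (var v) (var v) (tmp d.+2)]
  ++ c ++
  [:: Const (tmp d.+3) 1; Add (tmp d.+2) (tmp d.+2) (tmp d.+3);
      Const (tmp d.+3) 0; JumpZ (tmp d.+3) (pc + 5);
      Const (var v) 0; Add (var v) (var v) (tmp d)].

(** Four doublings replace a multiplication by 16, turning an index into the address of an array
    entry. *)
Definition cell_code d (a : array) : program :=
  [:: Add (tmp d) (tmp d) (tmp d); Add (tmp d) (tmp d) (tmp d);
      Add (tmp d) (tmp d) (tmp d); Add (tmp d) (tmp d) (tmp d);
      Const (tmp d.+1) a.+2; Add (tmp d) (tmp d) (tmp d.+1)].

Arguments loop_code : simpl never.

(** The result is left in [tmp d], and [tmp d] and later scratch registers may be overwritten; [pc]
    is the position of the code, needed for absolute jumps. In a [Sum], [tmp d] accumulates, the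
    next four registers belong to the loop, and the summand is computed from [tmp (d + 5)] on. *)
Fixpoint expr_code (e : expr) (d pc : nat) : program :=
  match e with
  | Var v => [:: Const (tmp d) 0; Add (tmp d) (tmp d) (var v)]
  | Cst n => [:: Const (tmp d) n]
  | Plus e1 e2 =>
      let c1 := expr_code e1 d pc in
      c1 ++ expr_code e2 d.+1 (pc + size c1) ++
      [:: Add (tmp d) (tmp d) (tmp d.+1)]
  | Minus e1 e2 =>
      let c1 := expr_code e1 d pc in
      c1 ++ expr_code e2 d.+1 (pc + size c1) ++
      [:: Defs.Sub (tmp d) (tmp d) (tmp d.+1)]
  | Get a e1 =>
      expr_code e1 d pc ++ cell_code d a ++ [:: Fetch (tmp d) (tmp d)]
  | Sum v b e1 =>
      Const (tmp d) 0 ::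
      loop_code v b d.+1 pc.+1 (fun pc =>
        expr_code e1 (d + 5) pc ++ [:: Add (tmp d) (tmp d) (tmp (d + 5))])
  end.

Fixpoint cmd_code (c : cmd) (d pc : nat) : program :=
  match c with
  | Put a e1 e2 =>
      let c1 := expr_code e2 d pc in
      c1 ++ expr_code e1 d.+1 (pc + size c1) ++ cell_code d.+1 a ++
      [:: Store (tmp d.+1) (tmp d)]
  | Input v => [:: Read (var v)]
  | Seq c1 c2 =>
      let p1 := cmd_code c1 d pc in p1 ++ cmd_code c2 d (pc + size p1)
  | For v b c1 => loop_code v b d pc (cmd_code c1 (d + 4))
  end.

(** * Running times as polynomials in a bound on the variables *)

Section TimePolynomials.

Import GRing.Theory.
Local Open Scope ring_scope.

(** Each iteration costs four instructions before the body and four after it. The 9 consists of five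
    initial instructions, two for the test that leaves the loop, and two that restore the loop
    variable. *)
Definition loop_time (p : {poly nat}) : {poly nat} := 'X * (p + 8%N%:P) + 9%N%:P.

Fixpoint expr_time (e : expr) : {poly nat} :=
  match e with
  | Var _ => 2%N%:P
  | Cst _ => 1%N%:P
  | Plus e1 e2 | Minus e1 e2 => expr_time e1 + (expr_time e2 + 1%N%:P)
  | Get _ e1 => expr_time e1 + 7%N%:P
  | Sum _ _ e1 => loop_time (expr_time e1 + 1%N%:P) + 1%N%:P
  end.

Fixpoint cmd_time (c : cmd) : {poly nat} :=
  match c with
  | Put _ e1 e2 => expr_time e2 + (expr_time e1 + 7%N%:P)
  | Input _ => 1%N%:P
  | Seq c1 c2 => cmd_time c1 + cmd_time c2
  | For _ _ c1 => loop_time (cmd_time c1)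
  end.

Lemma horner_loop_time p M :
  (loop_time p).[M] = (M * (p.[M] + 8) + 9)%N.
Proof. by rewrite /loop_time !(hornerD, hornerM, hornerX, hornerC). Qed.

End TimePolynomials.

(** * Correctness and running time of the compiled code *)

Section Execution.

Variable P : program.

Lemma config_eq pc pc' R w : pc = pc' -> Config pc R w = Config pc' R w.
Proof. by move->. Qed.

Definition instr_at pc i := onth P pc = Some i.

Fixpoint code_at pc (c : program) : Prop :=
  if c is i :: c1 then instr_at pc i /\ code_at pc.+1 c1 else True.

Lemma code_at_cat pc c1 c2 :
  code_at pc (c1 ++ c2) <-> code_at pc c1 /\ code_at (pc + size c1) c2.
Proof.
elim: c1 pc => [|i c1 IH] pc /=; first by rewrite addn0; tauto.
by rewrite IH addSnnS; tauto.
Qed.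

(** The remaining fuel [m] is arbitrary, so that executions can be chained; [T] only bounds the
    number of steps from above. *)
Definition reaches T (c : config) (Q : config -> Prop) : Prop :=
  exists n c', [/\ n <= T, forall m, run P (n + m) c = run P m c' & Q c'].

Lemma reaches_refl c (Q : config -> Prop) : Q c -> reaches 0 c Q.
Proof. by exists 0, c. Qed.

Lemma reaches_seq T1 T2 c Q :
  reaches T1 c (fun c' => reaches T2 c' Q) -> reaches (T1 + T2) c Q.
Proof.
move=> [n1 [c1 [le1 run1 [n2 [c2 [le2 run2 Qc2]]]]]].
exists (n1 + n2), c2; split=> // [|m]; first exact: leq_add.
by rewrite -addnA run1 run2.
Qed.

Lemma reaches_weak T1 T2 c (Q1 Q2 : config -> Prop) :
  reaches T1 c Q1 -> T1 <= T2 -> (forall c', Q1 c' -> Q2 c') ->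
  reaches T2 c Q2.
Proof.
move=> [n [c' [le_n run_n Qc']]] leT Q12; exists n, c'.
by split; [exact: leq_trans leT | | exact: Q12].
Qed.

Lemma reaches_le T1 T2 c Q : T1 <= T2 -> reaches T1 c Q -> reaches T2 c Q.
Proof. by move=> leT /reaches_weak; apply. Qed.

Definition halting i := if i is Halt _ then true else false.

Lemma reaches_step T pc pc0 R w i Q :
  instr_at pc0 i -> pc = pc0 -> ~~ halting i ->
  reaches T (exec i (Config pc R w)) Q -> reaches T.+1 (Config pc R w) Q.
Proof.
rewrite /instr_at => Pi -> nhalt [n [c' [le_n run_n Qc']]].
by exists n.+1, c'; split=> // m; rewrite addSn /= Pi -run_n; case: i Pi nhalt run_n.
Qed.

(** Comparisons between registers are linear arithmetic once the addresses are unfolded. *)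
Ltac reg_neq := rewrite ?/var ?/tmp ?/cell; lia.

Ltac reg_simpl :=
  rewrite /=; repeat match goal with
  | |- context [?a == ?a] => rewrite (eqxx a)
  | |- context [@eq_op _ ?a ?b] =>
      rewrite (_ : @eq_op Datatypes_nat__canonical__eqtype_Equality a b = false);
        [ | reg_neq]
  end.

Ltac step E :=
  apply: (reaches_step E); [by lia | by [] | rewrite /=; reg_simpl].

(** Code for an expression compiled at depth [d] may overwrite only these registers, so that values
    kept in [tmp i] with [i < d] survive. *)
Definition scratch d r := (r %% 16 == 1) && (tmp d <= r).

Definition frame d (R R' : nat -> nat) := forall r, ~~ scratch d r -> R' r = R r.

Lemma frame_trans d d' R1 R2 R3 :
  d <= d' -> frame d R1 R2 -> frame d' R2 R3 -> frame d R1 R3.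
Proof.
move=> le_d fr12 fr23 r sr; rewrite fr23 ?fr12 //.
by apply: contra sr; rewrite /scratch /tmp; lia.
Qed.

Lemma frame_tmp d R R' i : frame d R R' -> i < d -> R' (tmp i) = R (tmp i).
Proof. by move=> fr lt_id; apply: fr; rewrite /scratch /tmp; lia. Qed.

Lemma frame_var d R R' v : frame d R R' -> R' (var v) = R (var v).
Proof. by move=> fr; apply: fr; rewrite /scratch /tmp /var; lia. Qed.

Lemma frame_cell d R R' a i : frame d R R' -> R' (cell a i) = R (cell a i).
Proof.
move=> fr; apply: fr; rewrite /scratch /tmp /cell.
by have := ltn_ord a; lia.
Qed.

Lemma store_of_frame d R R' w : frame d R R' -> store_of R' w = store_of R w.
Proof.
move=> fr; congr St; apply: funext => v; first exact: frame_var fr.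
by apply: funext => i; apply: frame_cell fr.
Qed.

Lemma code_at_loop_body v b d pc body :
  code_at pc (loop_code v b d pc body) -> code_at (pc + 9) (body (pc + 9)).
Proof.
rewrite /loop_code /= => -[_ [_ [_ [_ [_ [_ [_ [_ [_]]]]]]]]].
by rewrite (_ : pc.+1.+4.+4 = pc + 9) ?code_at_cat; [case | lia].
Qed.

Lemma frame_upd d R j x : d <= j -> frame d R [eta R with tmp j |-> x].
Proof.
move=> le_dj r sr /=; case: eqP => // Er.
by case/negP: sr; rewrite Er /scratch /tmp; lia.
Qed.

Lemma loop_correct M (t : {poly nat}) pc d v b (body : nat -> program) R w
    (I : nat -> (nat -> nat) -> seq nat -> Prop) :
    code_at pc (loop_code v b d pc body) ->
    R (var b) <= M ->
    I 0 R w ->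
    (forall i R1 R2 w1, I i R1 w1 ->
       (forall r, r != var v -> r \notin [seq tmp j | j <- iota d 4] ->
          R2 r = R1 r) -> I i R2 w1) ->
    (forall i R1 w1, i < R (var b) -> I i R1 w1 -> R1 (var v) = i ->
       reaches t.[M]%R (Config (pc + 9) R1 w1) (fun c' => exists R2 w2,
         [/\ c' = Config (pc + 9 + size (body (pc + 9))) R2 w2, I i.+1 R2 w2 &
             forall j, d <= j < d + 4 -> R2 (tmp j) = R1 (tmp j)])) ->
  reaches (loop_time t).[M]%R (Config pc R w) (fun c' => exists R' w',
    [/\ c' = Config (pc + size (loop_code v b d pc body)) R' w',
        I (R (var b)) R' w' & R' (var v) = R (var v)]).
Proof.
set c := body (pc + 9) => code_c leM I0 I_frame I_body.
move: code_c; rewrite /loop_code -/c /=.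
case=> [i0 [i1 [i2 [i3 [i4 [i5 [i6 [i7 [i8]]]]]]]]].
case/code_at_cat=> _ /= [j0 [j1 [j2 [j3 [j4 [j5 _]]]]]].
set pc_end := pc + (size c + 13) in i6 *.
(* Induction on the number [k] of iterations still to come; the 2 pays for the test that leaves the
   loop. *)
have iter_ok k : forall i R1 w1, i + k = R (var b) -> I i R1 w1 ->
    R1 (tmp d) = R (var v) -> R1 (tmp d.+1) = R (var b) -> R1 (tmp d.+2) = i ->
  reaches (k * (t.[M]%R + 8) + 2) (Config (pc + 5) R1 w1) (fun c' =>
    exists R' w', [/\ c' = Config pc_end R' w', I (R (var b)) R' w' &
      R' (tmp d) = R (var v)]).
  elim: k => [|k IH] i R1 w1 Ei Ii Rd Rd1 Rd2.
    rewrite mul0n add0n; step i5; step i6.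
    rewrite Rd1 Rd2; have -> : R (var b) - i = 0 by lia.
    apply: reaches_refl; eexists _, w1; split; first by [].
      have <- : i = R (var b) by lia.
      apply: I_frame Ii _ => r _; rewrite !inE => nr /=.
      by case: eqP => // Er; move: nr; rewrite Er eqxx !orbT.
    by rewrite /=; reg_simpl.
  rewrite (_ : _ + 2 = (t.[M]%R + (k * (t.[M]%R + 8) + 2).+4).+4); last by lia.
  step i5; step i6; rewrite Rd1 Rd2; have /negPf-> : R (var b) - i != 0 by lia.
  step i7; step i8.
  set R2 := (X in Config _ X _).
  have -> : (pc + 5).+4 = pc + 9 by lia.
  have I2 : I i R2 w1.
    apply: I_frame Ii _ => r nv; rewrite !inE => nr.
    rewrite /R2 /= (negPf nv); case: eqP => // Er.
    by move: nr; rewrite Er eqxx !orbT.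
  have Ev : R2 (var v) = i by rewrite /R2 /= eqxx.
  apply: reaches_seq.
  apply: reaches_weak (I_body _ _ _ _ I2 Ev) (leqnn _) _; first by lia.
  move=> c' [R3 [w3 [-> I3 E3]]].
  have {E3} [F0 F1 F2] : [/\ R3 (tmp d) = R1 (tmp d), R3 (tmp d.+1) = R1 (tmp d.+1)
      & R3 (tmp d.+2) = R1 (tmp d.+2)].
    by rewrite !E3 /R2 /=; try lia; reg_simpl.
  step j0; step j1; step j2; step j3.
  apply: IH => /=; reg_simpl; rewrite ?F0 ?F1 ?F2 ?Rd2 ?addn1 //; first by lia.
  apply: I_frame I3 _ => r nv; rewrite !inE !negb_or /= => /and4P[n0 n1 n2 n3].
  by rewrite (negPf n2) (negPf n3).
rewrite horner_loop_time.
have leT : (5 + (R (var b) * (t.[M]%R + 8) + 2)).+2 <= M * (t.[M]%R + 8) + 9.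
  by have := leq_mul leM (leqnn (t.[M]%R + 8)); lia.
apply: (reaches_le leT).
rewrite (_ : (_ + _).+2 = (R (var b) * (t.[M]%R + 8) + 2 + 2).+1.+4); last by lia.
step i0; step i1; step i2; step i3; step i4.
set R1 := (X in Config _ X _).
have := iter_ok (R (var b)) 0 R1 w (add0n _) _ _ _ _.
rewrite (_ : pc.+1.+4 = pc + 5); last by lia.
have F0 : R1 (tmp d) = R (var v) by rewrite /R1 /=; reg_simpl.
have F1 : R1 (tmp d.+1) = R (var b) by rewrite /R1 /=; reg_simpl.
have F2 : R1 (tmp d.+2) = 0 by rewrite /R1 /=; reg_simpl.
have F3 : I 0 R1 w.
  apply: I_frame I0 _ => r nv; rewrite !inE !negb_or /= => /and4P[n0 n1 n2 n3].
  by rewrite /R1 /= (negPf n0) (negPf n1) (negPf n2).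
move=> /(_ F3 F0 F1 F2) main.
apply: reaches_seq; apply: reaches_weak main (leqnn _) _.
move=> c' [R2 [w2 [-> I2 E2]]]; rewrite /pc_end; step j4; step j5.
apply: reaches_refl; eexists _, w2; split.
- by rewrite size_cat /=; apply: config_eq; lia.
- by apply: I_frame I2 _ => r nv _ /=; rewrite (negPf nv).
- by rewrite /= eqxx add0n.
Qed.

Lemma setvv s v x y : setv (setv s v x) v y = setv s v y.
Proof. by congr St; apply: funext => u /=; case: eqP. Qed.

Lemma setv_id s v : setv s v (vars s v) = s.
Proof. by case: s => V A w; congr St; apply: funext => u /=; case: eqP => [->|]. Qed.

Lemma store_of_setv R R1 w v :
  (forall r, r != var v -> ~~ scratch 0 r -> R1 r = R r) ->
  store_of R1 w = setv (store_of R w) v (R1 (var v)).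
Proof.
move=> eqR; congr St; apply: funext => u /=.
  case: eqP => [-> // | /eqP neq]; apply: eqR; rewrite /scratch /var /tmp; lia.
by apply: funext => i; apply: eqR; have := ltn_ord u; rewrite /scratch /var /tmp /cell; lia.
Qed.

Lemma cell_correct pc d a R w :
  code_at pc (cell_code d a) ->
  reaches 6 (Config pc R w) (fun c' => exists R',
    [/\ c' = Config (pc + 6) R' w, R' (tmp d) = cell a (R (tmp d)) &
        forall r, r != tmp d -> r != tmp d.+1 -> R' r = R r]).
Proof.
rewrite /cell_code /= => -[i0 [i1 [i2 [i3 [i4 [i5 _]]]]]].
step i0; step i1; step i2; step i3; step i4; step i5.
apply: reaches_refl; eexists; split=> /=.
- by apply: config_eq; lia.
- by reg_simpl; rewrite /cell; lia.

by move=> r /= /negPf-> /negPf->.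
Qed.

Lemma expr_correct M e d pc R w :
  code_at pc (expr_code e d pc) -> (forall v, R (var v) <= M) ->
  reaches (expr_time e).[M]%R (Config pc R w) (fun c' => exists R',
    [/\ c' = Config (pc + size (expr_code e d pc)) R' w,
        R' (tmp d) = eval (store_of R w) e & frame d R R']).
Proof.
elim: e d pc R w => [v|n|e1 IH1 e2 IH2|e1 IH1 e2 IH2|a e IH|v b e IH] d pc R w /=.
- case=> i0 [i1 _] _; rewrite hornerC; step i0; step i1.
  apply: reaches_refl; eexists; split=> /=; [by apply: config_eq; lia | by reg_simpl |].
  by apply: frame_trans (leqnn d) _ _; apply: frame_upd.
- case=> i0 _ _; rewrite hornerC; step i0.
  apply: reaches_refl; eexists; split=> /=; [by apply: config_eq; lia | by reg_simpl |].
  exact: frame_upd.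
- case/code_at_cat=> C1 /code_at_cat[C2 [i0 _]] leM; rewrite !hornerD hornerC.
  apply: reaches_seq; apply: reaches_weak (IH1 _ _ _ _ C1 leM) (leqnn _) _.
  move=> _ [R1 [-> E1 F1]].
  have leM1 v : R1 (var v) <= M by rewrite (frame_var _ F1).
  apply: reaches_seq; apply: reaches_weak (IH2 _ _ _ _ C2 leM1) (leqnn _) _.
  move=> _ [R2 [-> E2 F2]]; step i0.
  apply: reaches_refl; eexists; split=> /=.
  + by apply: config_eq; rewrite !size_cat /=; lia.
  + by reg_simpl; rewrite E2 (frame_tmp F2) // E1 (store_of_frame _ F1).
  + apply: frame_trans (leqnn d) _ (frame_upd _ _ (leqnn d)).
    exact: frame_trans (leqnSn d) F1 F2.
- case/code_at_cat=> C1 /code_at_cat[C2 [i0 _]] leM; rewrite !hornerD hornerC.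
  apply: reaches_seq; apply: reaches_weak (IH1 _ _ _ _ C1 leM) (leqnn _) _.
  move=> _ [R1 [-> E1 F1]].
  have leM1 v : R1 (var v) <= M by rewrite (frame_var _ F1).
  apply: reaches_seq; apply: reaches_weak (IH2 _ _ _ _ C2 leM1) (leqnn _) _.
  move=> _ [R2 [-> E2 F2]]; step i0.
  apply: reaches_refl; eexists; split=> /=.
  + by apply: config_eq; rewrite !size_cat /=; lia.
  + by reg_simpl; rewrite E2 (frame_tmp F2) // E1 (store_of_frame _ F1).
  + apply: frame_trans (leqnn d) _ (frame_upd _ _ (leqnn d)).
    exact: frame_trans (leqnSn d) F1 F2.
- case/code_at_cat=> C1 /(@code_at_cat _ (cell_code d a))[C2 [i0 _]] leM.
  have size6 : size (cell_code d a) = 6 by [].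
  rewrite hornerD hornerC.
  apply: reaches_seq; apply: reaches_weak (IH _ _ _ _ C1 leM) (leqnn _) _.
  move=> _ [R1 [-> E1 F1]].
  apply: (@reaches_seq 6 1); apply: reaches_weak (cell_correct R1 w C2) (leqnn _) _.
  move=> _ [R2 [-> E2 F2]]; step i0.
  have F12 : frame d R1 R2.
    by move=> r sr; apply: F2; apply: contra sr => /eqP->; rewrite /scratch /tmp; lia.
  apply: reaches_refl; eexists; split=> /=.
  + by apply: config_eq; rewrite !size_cat /=; lia.
  + by reg_simpl; rewrite E2 (frame_cell _ _ F12) (frame_cell _ _ F1) E1.
  + apply: frame_trans (leqnn d) _ (frame_upd _ _ (leqnn d)).
    exact: frame_trans (leqnn d) F1 F12.
- case=> i0 C leM; rewrite hornerD hornerC [(_ + _)%R]addn1; step i0.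
  pose body p := expr_code e (d + 5) p ++ [:: Add (tmp d) (tmp d) (tmp (d + 5))].
  have {}C : code_at pc.+1 (loop_code v b d.+1 pc.+1 body) := C.
  pose s0 := store_of R w.
  (* The accumulator holds the first [i] summands. Outside [v] and the scratch registers nothing
     changes, so each summand can be evaluated in [s0] with [v] updated. *)
  pose I i (R1 : nat -> nat) w1 := [/\ w1 = w,
    R1 (tmp d) = \sum_(j < i) eval (setv s0 v j) e &
    forall r, r != var v -> ~~ scratch d r -> R1 r = R r].
  set R0 := [eta R with _ |-> _].
  have ER0 u : R0 (var u) = R (var u) by rewrite /R0 /=; reg_simpl.
  have := @loop_correct M (expr_time e + 1%:P)%R _ d.+1 v b body R0 w I C.
  rewrite !ER0 => loop.
  apply: reaches_weak (loop (leM b) _ _ _) (leqnn _) _.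
  + split=> //; first by rewrite big_ord0 /R0 /= eqxx.
    move=> r nv sr; rewrite /R0 /=; case: eqP => // Er.
    by case/negP: sr; rewrite Er /scratch /tmp; lia.
  + move=> i R1 R2 w1 [-> sumE frE] E12; split=> //.
      by rewrite E12 //; [reg_neq | rewrite !inE; reg_neq].
    move=> r nv sr; rewrite E12 ?frE // !inE.
    by apply: contra sr; rewrite /scratch /tmp; lia.
  + move=> i R1 w1 lti [-> sumE frE] Ev /=.
    have /= /code_at_cat[{}C [j0 _]] := code_at_loop_body C; rewrite hornerD hornerC.
    have leM1 u : R1 (var u) <= M.
      case: (u =P v) => [->|/eqP neq]; first by rewrite Ev; have := leM b; lia.
      rewrite frE //; first by rewrite /var; lia.
      by rewrite /scratch /var /tmp; lia.
    apply: reaches_seq; apply: reaches_weak (IH _ _ _ _ C leM1) (leqnn _) _.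
    move=> _ [R2 [-> E2 F2]]; step j0.
    have F2d j : j < d + 5 -> R2 (tmp j) = R1 (tmp j) := frame_tmp F2.
    apply: reaches_refl; eexists _, w; split.
    * by apply: config_eq; rewrite size_cat /=; lia.
    * split=> //=.
        rewrite eqxx E2 F2d ?sumE ?big_ord_recr /=; last by lia.
        congr (_ + eval _ _); rewrite -Ev.
        apply: store_of_setv => r nv sr; apply: frE => //.
        by apply: contra sr; rewrite /scratch /tmp; lia.
      move=> r nv sr; case: eqP => [Er|_].
        by case/negP: sr; rewrite Er /scratch /tmp; lia.
      rewrite F2 ?frE //; apply: contra sr; rewrite /scratch /tmp; lia.
    * by move=> j ltj; reg_simpl; rewrite F2d; lia.
  move=> _ [R1 [w1 [-> [-> sumE frE] Ev]]]; exists R1; split.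
  + by apply: config_eq; rewrite /loop_code /= addSnnS.
  + exact: sumE.
  + move=> r sr; case: (r =P var v) => [->|/eqP nv]; last exact: frE.
    exact: Ev.
Qed.

Definition bounded M s := (forall v, vars s v <= M) /\ all (leq^~ M) (inp s).

Lemma bounded_setv M s v x : bounded M s -> x <= M -> bounded M (setv s v x).
Proof. by move=> [leM inM] lex; split=> // u /=; case: eqP. Qed.

(** A variable receives either an input number or a counter smaller than the value of another
    variable. *)
Lemma sem_bounded M c s : bounded M s -> bounded M (sem c s).
Proof.
elim: c s => [a e1 e2|v|c1 IH1 c2 IH2|v b c IH] s bs /=; first by [].
- have lex : head 0 (inp s) <= M by case: bs => _; case: (inp s) => //= x w /andP[].
  have [leM _] := bounded_setv v bs lex; split=> //=.
  by case: bs => _; case: (inp s) => //= x w /andP[].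
- exact/IH2/IH1.
apply: bounded_setv; last by have [] := bs.
have : vars s b <= M by have [] := bs.
elim: (vars s b) => // i IHi /= lei; apply/IH/bounded_setv; last exact: ltnW.
exact/IHi/ltnW.
Qed.

(** The last clause protects the bookkeeping registers of the enclosing loops. *)
Lemma cmd_correct M c d pc R w :
  code_at pc (cmd_code c d pc) -> bounded M (store_of R w) ->
  reaches (cmd_time c).[M]%R (Config pc R w) (fun c' => exists R' w',
    [/\ c' = Config (pc + size (cmd_code c d pc)) R' w',
        store_of R' w' = sem c (store_of R w) &
        forall j, j < d -> R' (tmp j) = R (tmp j)]).
Proof.
elim: c d pc R w => [a e1 e2|v|c1 IH1 c2 IH2|v b c IH] d pc R w /=.
- case/code_at_cat=> C1 /code_at_cat[C2].
  case/(@code_at_cat _ (cell_code d.+1 a)) => C3 [i0 _] [leM _].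
  have {}leM u : R (var u) <= M := leM u.
  have size6 : size (cell_code d.+1 a) = 6 by [].
  rewrite !hornerD hornerC.
  apply: reaches_seq; apply: reaches_weak (expr_correct w C1 leM) (leqnn _) _.
  move=> _ [R1 [-> E1 F1]].
  have leM1 u : R1 (var u) <= M by rewrite (frame_var _ F1).
  apply: reaches_seq; apply: reaches_weak (expr_correct w C2 leM1) (leqnn _) _.
  move=> _ [R2 [-> E2 F2]].
  apply: (@reaches_seq 6 1); apply: reaches_weak (cell_correct R2 w C3) (leqnn _) _.
  move=> _ [R3 [-> E3 F3]]; step i0.
  have F02 : frame d R R2 by apply: frame_trans F1 F2.
  have F23 : frame d.+1 R2 R3.
    by move=> r sr; apply: F3; apply: contra sr => /eqP->; rewrite /scratch /tmp; lia.
  have F03 : frame d R R3 by apply: frame_trans F02 F23.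
  have Ex : R3 (tmp d) = eval (store_of R w) e2.
    by rewrite (frame_tmp F23) // (frame_tmp F2) // E1.
  rewrite E3 E2 (store_of_frame _ F1) Ex.
  apply: reaches_refl; eexists _, w; split=> /=.
  + by apply: config_eq; rewrite !size_cat /=; lia.
  + rewrite -(store_of_frame w F03); congr St; apply: funext => u.
      reg_simpl; case: eqP => // Eu.
      by have := ltn_ord a; move: Eu; rewrite /var /cell; lia.
    apply: funext => i /=; congr (if _ then _ else _).
    apply/eqP/andP=> [|[/eqP-> /eqP-> //]].
    have := ltn_ord u; have := ltn_ord a; rewrite /cell => la lu Ec.
    by split; apply/eqP; [apply: val_inj => /=|]; lia.
  + move=> j ltj; reg_simpl; case: eqP => [|_]; last exact: frame_tmp F03 ltj.
    by have := ltn_ord a; rewrite /cell /tmp; lia.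
- case=> i0 _ _; rewrite hornerC; step i0.
  apply: reaches_refl; eexists _, (behead w); split=> /=.
  + by apply: config_eq; lia.
  + congr St; apply: funext => u /=.
      by congr (if _ then _ else _); apply/eqP/eqP; rewrite /var; lia.
    apply: funext => i; reg_simpl; case: eqP => // Eu.
    by have := ltn_ord u; move: Eu; rewrite /var /cell; lia.
  + by move=> j _; reg_simpl.
- case/code_at_cat=> C1 C2 bR; rewrite hornerD.
  apply: reaches_seq; apply: reaches_weak (IH1 _ _ _ _ C1 bR) (leqnn _) _.
  move=> _ [R1 [w1 [-> E1 F1]]].
  have bR1 : bounded M (store_of R1 w1) by rewrite E1; apply: sem_bounded.
  apply: reaches_weak (IH2 _ _ _ _ C2 bR1) (leqnn _) _.
  move=> _ [R2 [w2 [-> E2 F2]]]; exists R2, w2; split.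
  + by apply: config_eq; rewrite size_cat; lia.
  + by rewrite E2 E1.
  + by move=> j ltj; rewrite F2 ?F1.
move=> C bR.
have {}C : code_at pc (loop_code v b d pc (cmd_code c (d + 4))) := C.
set s0 := store_of R w in bR *.
have leb : R (var b) <= M by case: bR => leM _; apply: leM b.
pose f i s := sem c (setv s v i).
(* The stores are compared up to the value of [v], which the loop code overwrites between
   iterations; hence it is reset to 0 on both sides. *)
pose I i R1 w1 := setv (store_of R1 w1) v 0 = setv (iteri i f s0) v 0 /\
  forall j, j < d -> R1 (tmp j) = R (tmp j).
apply: reaches_weak (@loop_correct _ _ _ _ _ _ _ R w I C leb _ _ _) (leqnn _) _.
- by split.
- move=> i R1 R2 w1 [E1 F1] E12; split; last first.
    move=> j ltj; rewrite E12 ?F1 // ?inE; reg_neq.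
  rewrite -E1 (@store_of_setv R1 R2 _ v) ?setvv // => r nv sr; apply: E12 => //.
  by rewrite !inE; apply: contra sr; rewrite /scratch /tmp; lia.
- move=> i R1 w1 lti [E1 F1] Ev.
  have C1 := code_at_loop_body C.
  have Es : store_of R1 w1 = setv (iteri i f s0) v i.
    by rewrite -(setvv _ _ 0) -E1 setvv -Ev (setv_id (store_of R1 w1)).
  have bR1 : bounded M (store_of R1 w1).
    rewrite Es; apply: bounded_setv; last by lia.
    elim: i lti {E1 F1 Ev Es} => // i IHi lti /=.
    by apply/sem_bounded/bounded_setv; [apply: IHi; lia | lia].
  apply: reaches_weak (IH _ _ _ _ C1 bR1) (leqnn _) _.
  move=> _ [R2 [w2 [-> E2 F2]]]; exists R2, w2; split=> //.
    by split; [rewrite E2 Es | move=> j ltj; rewrite F2 ?F1 //; lia].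
  by move=> j /andP[_ ltj]; rewrite F2.
move=> _ [R1 [w1 [-> [E1 F1] Ev]]]; exists R1, w1; split=> //.
by rewrite -(setvv _ _ 0) -E1 setvv -Ev (setv_id (store_of R1 w1)).
Qed.

End Execution.


(** The machine accepts when [e] is 0, because [e] will count violations. *)
Definition decider (c : cmd) (e : expr) : program :=
  let p1 := cmd_code c 0 0 in
  let p2 := p1 ++ expr_code e 0 (size p1) in
  p2 ++ [:: JumpZ (tmp 0) (size p2).+2; Halt false; Halt true].

Definition start_store w := St (fun=> 0) (fun _ _ => 0) w.

Lemma code_at_suffix p q : code_at (p ++ q) (size p) q.
Proof.
elim: q p => //= i q IH p; split; last first.
  by have := IH (rcons p i); rewrite size_rcons cat_rcons.
by rewrite /instr_at onth_cat ltnn subnn.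
Qed.

Lemma run_decider c e : exists p : {poly nat}, forall M w, all (leq^~ M) w ->
  run (decider c e) p.[M]%R (start w) = Some (eval (sem c (start_store w)) e == 0).
Proof.
exists (cmd_time c + (expr_time e + 3%N%:P))%R => M w inM.
rewrite /decider; set p1 := cmd_code c 0 0.
set ce := expr_code e 0 (size p1); set tl := [:: _; _; _].
set P := _ ++ tl; have := code_at_suffix [::] P.
rewrite {2}/P -catA => /code_at_cat[C1 /code_at_cat[C2 [i0 [i1 [i2 _]]]]].
have b0 : bounded M (store_of (fun=> 0) w) by [].
have main : reaches P ((cmd_time c).[M]%R + ((expr_time e).[M]%R + 1))
    (start w) (fun c' =>
    onth P (counter c') = Some (Halt (eval (sem c (start_store w)) e == 0))).
  apply: reaches_seq; apply: reaches_weak (cmd_correct C1 b0) (leqnn _) _.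
  move=> _ [R1 [w1 [-> E1 _]]].
  have leM1 u : R1 (var u) <= M.
    by have [+ _] := sem_bounded c b0; rewrite -E1 => /(_ u).
  apply: reaches_seq; apply: reaches_weak (expr_correct w1 C2 leM1) (leqnn _) _.
  move=> _ [R2 [-> E2 _]]; rewrite -[size (cmd_code _ _ _)]/(size p1) -/ce.
  apply: (reaches_step i0) => //; apply: reaches_refl; rewrite /= E2 E1.
  case: ifP => _; last exact: i1.
  by rewrite size_cat; exact: i2.
have [n [c' [le_n run_n Hc']]] := main.
rewrite !hornerD hornerC.
(* After the [n] steps at least one unit of fuel must be left for reading the [Halt]. *)
have [m ->] : exists m, ((cmd_time c).[M] + ((expr_time e).[M] + 3%N))%R = n + m.+1.
  exists ((cmd_time c).[M]%R + ((expr_time e).[M]%R + 2) - n).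
  move: le_n; rewrite -[LHS]/((cmd_time c).[M]%R + ((expr_time e).[M]%R + 3)); lia.
by rewrite run_n /= Hc'.
Qed.

(** * Synchronized runs of an automaton *)

Section StableIteration.

Variables (T : finType) (f : {set T} -> {set T}) (X : {set T}).

(** As long as the sets shrink strictly, each step removes an element; after [#|T|] strict steps the
    set is empty and cannot shrink further. *)
Lemma iter_decr_stable k : (forall j, iter j.+1 f X \subset iter j f X) ->
  #|T| <= k -> iter k.+1 f X = iter k f X.
Proof.
move=> decr le_Tk.
have [//|le_kT] : iter k.+1 f X = iter k f X \/ #|iter k f X| + k <= #|T|.
  elim: k {le_Tk} => [|k [IH|IH]]; first by right; rewrite addn0 max_card.
    by left; rewrite iterS IH.
  have [E|neq] := eqVneq (iter k.+1 f X) (iter k f X).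
    by left; rewrite iterS E.
  right; have := decr k; rewrite subEproper (negPf neq) orFb => /proper_card; lia.
have /eqP : #|iter k f X| = 0 by lia.
rewrite cards_eq0 => /eqP Ek; apply/eqP; rewrite eqEsubset decr Ek /=; exact: sub0set.
Qed.

Lemma iter_decr_const k j : (forall j, iter j.+1 f X \subset iter j f X) ->
  #|T| <= k -> iter (j + k) f X = iter k f X.
Proof.
move=> decr le_Tk; elim: j => // j IH.
by rewrite addSn iter_decr_stable //; apply: leq_trans le_Tk (leq_addl _ _).
Qed.

End StableIteration.

(** Complementation turns the increasing iteration into a decreasing one. *)
Lemma iter_incr_stable (T : finType) (f : {set T} -> {set T}) X k :
  (forall j, iter j f X \subset iter j.+1 f X) -> #|T| <= k ->
  iter k.+1 f X = iter k f X.
Proof.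
move=> incr le_Tk; pose g Y := ~: f (~: Y).
have E j : iter j g (~: X) = ~: iter j f X.
  by elim: j => //= j ->; rewrite /g setCK.
apply: setC_inj; rewrite -!E; apply: iter_decr_stable => // j.
by rewrite !E setCS.
Qed.

Section Automaton.

Variable A : fsa.
Implicit Types (x y z : state A) (s : seq (event A)) (w : seq (letter A)).

Lemma run_word_cat x y s1 s2 :
  run_word x (s1 ++ s2) y <-> exists2 z, run_word x s1 z & run_word z s2 y.
Proof.
elim: s1 x => [|t s1 IH] x /=; first by split=> [r|[z -> //]]; exists x.
split=> [[z tr /IH[u r1 r2]]|[u [z tr r1] r2]]; first by exists u => //; exists z.
by exists z => //; apply/IH; exists u.
Qed.

Definition reads w x y := exists2 s, label_word s = w & run_word x s y.

Lemma label_word_cat s1 s2 :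
  label_word (s1 ++ s2) = label_word s1 ++ label_word s2.
Proof. exact: pmap_cat. Qed.

Lemma reads_nil x : reads [::] x x.
Proof. by exists [::]. Qed.

Lemma label_word_split s w1 w2 : label_word s = w1 ++ w2 ->
  exists s1 s2, [/\ s = s1 ++ s2, label_word s1 = w1 & label_word s2 = w2].
Proof.
elim: s w1 => [|t s IH] w1.
  by case: w1 => // E; exists [::], [::].
case: w1 => [E|a w1]; first by exists [::], (t :: s).
rewrite /label_word /=; case lt: (label t) => [b|] /=.
  case=> Eb /IH[s1 [s2 [-> E1 E2]]]; exists (t :: s1), s2; split=> //.
  by rewrite /label_word /= lt /= -E1 Eb.
move=> /(IH (a :: w1))[s1 [s2 [-> E1 E2]]]; exists (t :: s1), s2; split=> //.
by rewrite /label_word /= lt /= -E1.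
Qed.

Lemma reads_cat w1 w2 x y :
  reads (w1 ++ w2) x y <-> exists2 z, reads w1 x z & reads w2 z y.
Proof.
split=> [[s /label_word_split[s1 [s2 [-> E1 E2]]] /run_word_cat[z r1 r2]]|].
  by exists z; [exists s1 | exists s2].
move=> [z [s1 E1 r1] [s2 E2 r2]]; exists (s1 ++ s2).
  by rewrite label_word_cat E1 E2.
by apply/run_word_cat; exists z.
Qed.

Definition silent x y := [exists t, ((x, t, y) \in trans A) && (label t == None)].

Lemma reads_silent x y : reads [::] x y <-> connect silent x y.
Proof.
split=> [[s]|/connectP[p]].
  elim: s x => [|t s IH] x; first by move=> _ ->.
  rewrite /label_word /=; case lt: (label t) => //= /IH{}IH [z tr /IH].
  by apply: connect_trans; apply/connect1/existsP; exists t; rewrite tr lt.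
elim: p x => [|z p IH] x /=; first by move=> _ ->; apply: reads_nil.
case/andP=> /existsP[t /andP[tr /eqP lt]] /IH{}IH /IH[s E r].
by exists (t :: s); [rewrite /label_word /= lt | exists z].
Qed.

(** This is the form that the program can test: it runs through the list of transitions and looks up
    silent reachability in a table. *)
Lemma reads1 a x y : reads [:: a] x y <->
  exists e, [/\ e \in trans A, label e.1.2 = Some a,
    reads [::] x e.1.1 & reads [::] e.2 y].
Proof.
split=> [[s]|].
  elim: s x => [|t s IH] x //; rewrite /label_word /=.
  case lt: (label t) => [b|] /=.
    case=> Eb E [z tr r]; exists (x, t, z); split=> //=; last by exists s.
      by rewrite lt Eb.
    exact: reads_nil.
  move=> /IH{}IH [z tr /IH[e [te le [s1 E1 r1] r2]]]; exists e; split=> //.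
  by exists (t :: s1); [rewrite /label_word /= lt | exists z].
move=> [[[u t] v] /= [tr lt [s1 E1 r1] [s2 E2 r2]]].
exists (s1 ++ t :: s2).
  by rewrite label_word_cat E1 /label_word /= lt /= -/(label_word s2) E2.
by apply/run_word_cat; exists u => //; exists v.
Qed.

(** * The threefold synchronized product *)

Definition triple : finType := (state A * state A * state A)%type.

Definition treads w (p q : triple) :=
  [/\ reads w p.1.1 q.1.1, reads w p.1.2 q.1.2 & reads w p.2 q.2].

Lemma treads_cat w1 w2 p q :
  treads (w1 ++ w2) p q <-> exists2 r, treads w1 p r & treads w2 r q.
Proof.
split=> [[/reads_cat[x x1 x2] /reads_cat[y y1 y2] /reads_cat[z z1 z2]]|].
  by exists (x, y, z); split.
by move=> [r [x1 y1 z1] [x2 y2 z2]]; split; apply/reads_cat; eexists; eassumption.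
Qed.

Lemma treads_nil p : treads [::] p p.
Proof. by split; apply: reads_nil. Qed.

Definition pre (S : {set triple}) : {set triple} :=
  [set p | `[< exists2 q, q \in S & exists a, treads [:: a] p q >]].

Lemma preP S p : p \in pre S <-> exists2 q, q \in S & exists a, treads [:: a] p q.
Proof. by rewrite inE; split=> [/asboolP|h]; last apply/asboolP. Qed.

Definition silent_closed (S : {set triple}) :=
  forall p q, treads [::] p q -> q \in S -> p \in S.

Lemma preS (S1 S2 : {set triple}) : S1 \subset S2 -> pre S1 \subset pre S2.
Proof.
by move=> /subsetP sub; apply/subsetP => p /preP[q /sub S2q h]; apply/preP; exists q.
Qed.

Lemma iter_preS k (S1 S2 : {set triple}) :
  S1 \subset S2 -> iter k pre S1 \subset iter k pre S2.
Proof. by move=> sub; elim: k => //= k; apply: preS. Qed.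

(** For [k = 0] the left side is [S] itself while the empty word still allows silent moves, whence
    the condition. For positive [k] the first application of [pre] absorbs them. *)
Lemma iter_preP k S p : 0 < k \/ silent_closed S ->
  p \in iter k pre S <-> exists w q, [/\ size w = k, q \in S & treads w p q].
Proof.
elim: k p => [|k IH] p hk.
  case: hk => // cl; split=> [pS|[w [q [/size0nil-> qS pq]]]]; last exact: cl qS.
  by exists [::], p; split=> //; apply: treads_nil.
case: (posnP k) => [->|k_gt0].
  split=> [/preP[q qS [a pq]]|[w [q [sw qS pq]]]]; first by exists [:: a], q.
  by case: w sw pq => [|a []] // _ pq; apply/preP; exists q => //; exists a.
have {}IH q := IH q (or_introl k_gt0).
rewrite iterS; split=> [/preP[r /IH[w [q [sw qS rq]]] [a pr]]|].
  by exists (a :: w), q; rewrite /= sw; split=> //; apply/(treads_cat [:: a]); exists r.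
move=> [[|a w] [q [//= [sw] qS /(treads_cat [:: a])[r pr rq]]]].
by apply/preP; exists r; [apply/IH; exists w, q | exists a].
Qed.

(** Three equal components can follow the same run, so that observations from a single state are
    handled by the same operator [pre]. *)
Definition diag x : triple := (x, x, x).

Lemma diag_iter_pre k x :
  diag x \in iter k pre setT <-> exists w y, size w = k /\ reads w x y.
Proof.
rewrite iter_preP; last by right.
split=> [[w [q [sw _ [r _ _]]]]|[w [y [sw r]]]]; first by exists w, q.1.1.
by exists w, (diag y).
Qed.

(** * Infinite runs with infinitely many observations *)

Definition endless x (t : nat -> event A) := exists xs : nat -> state A,
  [/\ xs 0 = x, forall i, (xs i, t i, xs i.+1) \in trans A &
      forall m, exists n, m <= size (label_word (mkseq t n))].

Lemma mkseq_add (T : Type) (t : nat -> T) m n :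
  mkseq t (m + n) = mkseq t m ++ mkseq (fun i => t (m + i)) n.
Proof.
rewrite /mkseq iotaD map_cat add0n; congr (_ ++ _).
by rewrite -[in LHS](addn0 m) iotaDl -map_comp.
Qed.

Lemma run_word_mkseq (t : nat -> event A) (xs : nat -> state A) n :
  (forall i, (xs i, t i, xs i.+1) \in trans A) ->
  run_word (xs 0) (mkseq t n) (xs n).
Proof.
move=> tr; elim: n => // n IH; rewrite -addn1 mkseq_add; apply/run_word_cat.
by exists (xs n) => //=; exists (xs n.+1); rewrite ?addn0 ?addn1.
Qed.

Lemma endless_cat s t x y : run_word x s y -> endless y t ->
  exists t', mkseq t' (size s) = s /\ endless x t'.
Proof.
elim: s x => [|e s IH] x /=; first by move=> ->; exists t.
case=> z tr /IH{}IH /IH[t' [E [xs [x0 trs unb]]]].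
pose t1 i := if i is j.+1 then t' j else e.
have Emk n : mkseq t1 n.+1 = e :: mkseq t' n by rewrite -add1n mkseq_add.
exists t1; rewrite Emk E; split=> //.
exists (fun i => if i is j.+1 then xs j else x); split=> // [[|i]|m] //=.
  by rewrite x0.
have [n le_mn] := unb m; exists n.+1; rewrite Emk /label_word /=.
by apply: leq_trans le_mn _; case: (label e).
Qed.

(* The infinite run is generated by a transition function on pairs of a state and
   a word still to be read from it; either an observation occurs or the pending
   word gets shorter, so observations occur infinitely often. *)
Lemma endless_of_invariant (P : state A -> Prop) x :
  (forall x, P x -> exists a y, reads [:: a] x y /\ P y) -> P x ->
  exists t, endless x t.
Proof.
move=> next Px.
have [_ [_ [/reads1[[[_ e0] _] _] _]]] := next _ Px.
pose I (d : state A * seq (event A)) :=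
  exists2 y, run_word d.1 d.2 y /\ P y & label_word d.2 != [::].
have ex_I y : P y -> exists s, I (y, s).
  move=> /next[a [z [[s E r] Pz]]]; exists s, z => //=; by rewrite E.
have step d : exists o : event A * (state A * seq (event A)), I d ->
    [/\ (d.1, o.1, o.2.1) \in trans A, I o.2 &
        label o.1 != None \/ size o.2.2 < size d.2].
  (* The event [e0] only makes the transition function total outside the invariant. *)
  have [[y [r Py] lab]|nI] := pselect (I d); last by exists (e0, d).
  case: d r lab => z [|e s] //= [u tr r] lab.
  (* If the rest of the pending word still contains an observation, it is kept and is shorter.
     Otherwise [e] is observable, and a fresh word is appended to the rest. *)
  have [E|nE] := eqVneq (label_word s) [::]; last first.
    by exists (e, (u, s)); split; [|exists y|right].
  have [s1 [y1 [/= r1 Py1] E1]] := ex_I _ Py.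
  exists (e, (u, s ++ s1)); split=> //=.
    exists y1 => /=; first by split=> //; apply/run_word_cat; exists y.
    by rewrite label_word_cat E.
  left; move: lab; rewrite /label_word /=; case: (label e) => //=.
  by rewrite -/(label_word s) E.
have [s Is] := ex_I _ Px.
have [g gP] := choice step.
pose d i := iter i (fun d => (g d).2) (x, s).
pose t i := (g (d i)).1.
have Id i : I (d i) by elim: i => //= i IH; have [] := gP _ IH.
exists t, (fun i => (d i).1); split=> // [i|m]; first by have [] := gP _ (Id i).
have visible i : exists2 j, i <= j & label (t j) != None.
  elim: {i}_.+1 {-2}i (ltnSn (size (d i).2)) => // n IH i ltn.
  have [_ _ [lab|lt_size]] := gP _ (Id i); first by exists i.
  have [|j lt_ij lab] := IH i.+1; first by apply: leq_trans lt_size _.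
  by exists j => //; apply: ltnW.
elim: m => [|m [n le_mn]]; first by exists 0.
have [j le_nj lab] := visible n; exists j.+1.
have mono : size (label_word (mkseq t n)) <= size (label_word (mkseq t j)).
  by rewrite -(subnKC le_nj) mkseq_add label_word_cat size_cat leq_addr.
rewrite -[j.+1]addn1 mkseq_add label_word_cat size_cat.
apply: (@leq_ltn_trans (size (label_word (mkseq t j)))).
  exact: leq_trans le_mn mono.
by move: lab; rewrite /label_word /= addn0; case: (label (t j)) => //= a _; lia.
Qed.

Lemma omega_of_endless x t : x \in init A -> endless x t ->
  exists2 sigma, omega_language sigma &
    forall n, prefix_of (label_word (mkseq t n)) sigma.
Proof.
move=> x_init [xs [x0 trs unb]].
have [n1 lt_n1] := unb 1.
case E1: (label_word _) lt_n1 => [//|a0 w0] _.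
(* The first [g i] events carry at least [i + 1] labels, so that letter [i] can be read off there;
   the default [a0] is the first observation. *)
have [g gP] := choice (fun i => unb i.+1).
pose sigma i := nth a0 (label_word (mkseq t (g i))) i.
have pre_sigma n : prefix_of (label_word (mkseq t n)) sigma.
  apply: (@eq_from_nth _ a0); first by rewrite size_mkseq.
  move=> i lti; rewrite nth_mkseq // /sigma; have := gP i.
  have [le|lt] := leqP n (g i).
    by rewrite -(subnKC le) mkseq_add label_word_cat nth_cat lti.
  by rewrite -(subnKC (ltnW lt)) mkseq_add label_word_cat nth_cat => ->.
by exists sigma => //; exists t, xs; split=> //; rewrite x0.
Qed.

Lemma omega_reads sigma : omega_language sigma ->
  exists2 x, x \in init A & forall k, exists y, reads (mkseq sigma k) x y.
Proof.
move=> [t [xs [x_init trs [pre_sigma unb]]]]; exists (xs 0) => // k.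
have [n le_kn] := unb k.
have : reads (label_word (mkseq t n)) (xs 0) (xs n).
  by exists (mkseq t n) => //; apply: run_word_mkseq.
rewrite pre_sigma -(subnKC le_kn) mkseq_add => /reads_cat[y r _].
by exists y.
Qed.

(** * Detectability in terms of the product *)

Definition big := #|state A| * #|state A| * #|state A|.

Lemma card_triple : #|triple| = big.
Proof. by rewrite !card_prod. Qed.

Definition live : {set triple} := iter big pre setT.

Lemma pre_sub_iter k (S : {set triple}) : pre S \subset S ->
  iter k.+1 pre S \subset iter k pre S.
Proof. by move=> sub; rewrite iterSr; apply: iter_preS. Qed.

(** By stability a live state can read [big + 1] letters; after the first of them it is in a state
    that can read [big] letters, which is live again. Liveness is thus an invariant of the kind
    required. *)
Lemma live_endless x : diag x \in live -> exists t, endless x t.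
Proof.
apply: (@endless_of_invariant (fun x => diag x \in live)) => {}x.
rewrite /live -iter_decr_stable ?card_triple //; last first.
  by move=> j; apply: pre_sub_iter; apply: subsetT.
move=> /diag_iter_pre[[|a w] [y [// [sw] /(reads_cat [:: a])[z r1 r2]]]].
exists a, z; split=> //; rewrite iter_decr_stable ?card_triple //; last first.
  by move=> j; apply: pre_sub_iter; apply: subsetT.
by apply/diag_iter_pre; exists w, y.
Qed.

Variable K : nat.

Definition ambiguous : {set triple} :=
  iter K pre [set p : triple | diag p.2 \in live]
  :&: [set p : triple | p.1.1 != p.1.2].

Definition ancestors : {set triple} := iter big (fun S => S :|: pre S) ambiguous.

Definition remote : {set triple} := iter big pre ancestors.

Lemma ambiguousP x y z : (x, y, z) \in ambiguous <->
  x != y /\ exists w x' y' z', [/\ size w = K, diag z' \in live &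
    treads w (x, y, z) (x', y', z')].
Proof.
have cl : silent_closed [set p : triple | diag p.2 \in live].
  move=> p q [_ _ r]; rewrite !inE => /diag_iter_pre[w [y' [sw r']]].
  apply/diag_iter_pre; exists w, y'; split=> //.
  by apply/(reads_cat [::]); exists q.2.
rewrite !inE /=; split.
  move=> /andP[/(iter_preP _ (or_intror cl))[w [[[x' y'] z'] [sw + r]]] neq].
  by rewrite inE => lz; split=> //; exists w, x', y', z'.
move=> [-> [w [x' [y' [z' [sw lz r]]]]]]; rewrite andbT.
by apply/iter_preP; [right | exists w, (x', y', z'); rewrite inE].
Qed.

Lemma pre_ancestors : pre ancestors \subset ancestors.
Proof.
have {2}<- : iter big.+1 (fun S => S :|: pre S) ambiguous = ancestors.
  apply: iter_incr_stable; last by rewrite card_triple.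
  by move=> j; rewrite iterS subsetUl.
by rewrite iterS subsetUr.
Qed.

Lemma ancestorsP p : p \in ancestors <-> exists j, p \in iter j pre ambiguous.
Proof.
split=> [|[j]].
  rewrite /ancestors; elim: big p => [|m IH] p; first by exists 0.
  rewrite iterS inE => /orP[/IH//|/preP[q /IH[j qj] pq]].
  by exists j.+1; apply/preP; exists q.
apply/subsetP; elim: j => [|j IH].
  rewrite /ancestors /=; elim: big => // m IH; apply: subset_trans IH _.
  by rewrite iterS subsetUl.
by apply: subset_trans pre_ancestors; apply: preS.
Qed.

Lemma detectableP : omega_delayed_strongly_detectable A K <->
  forall p : triple, p.1.1 \in init A -> p.1.2 \in init A -> p.2 \in init A ->
    p \notin remote.
Proof.
have estP w1 w2 x : x \in delayed_estimate w1 w2 <->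
    exists x0 x', [/\ x0 \in init A, reads w1 x0 x & reads w2 x x'].
  rewrite inE; split=> [/asboolP[x0 [x' [s1 [s2 [i E1 E2 r1 r2]]]]]|].
    by exists x0, x'; split=> //; [exists s1 | exists s2].
  move=> [x0 [x' [i [s1 E1 r1] [s2 E2 r2]]]].
  by apply/asboolP; exists x0, x', s1, s2.
split=> [[k det] [[x0 y0] z0] /= ix iy iz|far].
  apply/negP; rewrite /remote.
  (* Stability allows [k + 1] further applications of [pre], so that the word read before the
     ambiguous triple is longer than the given [k]. *)
  rewrite -(@iter_decr_const _ _ _ _ k.+1) ?card_triple //; last first.
    by move=> j; apply/pre_sub_iter/pre_ancestors.
  case/iter_preP; first by left.
  move=> w [p [sw /ancestorsP[j pj] wp]].
  have : (x0, y0, z0) \in iter (k.+1 + big + j) pre ambiguous.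
    rewrite iterD; apply/iter_preP; first by left.
    by exists w, p.
  case/iter_preP; first by left.
  move=> {wp sw p pj w} w1 [[[x y] z] [s1 amb wp]].
  have [neq [w2 [x' [y' [z' [s2 lz wq]]]]]] := iffLR (ambiguousP _ _ _) amb.
  have [t et] := live_endless lz.
  have [rx ry rz] := iffRL (treads_cat w1 w2 _ _) (ex_intro2 _ _ _ wp wq).
  case: rz => s Es rs.
  have [t' [Et' et']] := endless_cat rs et.
  have [sigma Lsigma pre_sigma] := omega_of_endless iz et'.
  have pw : prefix_of (w1 ++ w2) sigma by rewrite -Es -Et'.
  have le1 : k <= size w1 by rewrite s1; lia.
  have le2 : K <= size w2 by rewrite s2.
  have /eqP/cards1P[u Eu] := det _ Lsigma _ _ pw le1 le2.
  have [[r1x r1y _] [r2x r2y _]] := (wp, wq).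
  have : x \in delayed_estimate w1 w2 by apply/estP; exists x0, x'.
  have : y \in delayed_estimate w1 w2 by apply/estP; exists y0, y'.
  by rewrite Eu !inE => /eqP Ey /eqP Ex; rewrite Ey Ex eqxx in neq.
(* The threshold is [big]. A run on [sigma] is followed for [big] letters beyond [w1 ++ w2], which
   is enough to establish liveness. *)
exists big => sigma /omega_reads[z0 iz reads_sigma] w1 w2 pw le1 le2.
have [z' rz'] := reads_sigma (size (w1 ++ w2) + big).
move: rz'; rewrite mkseq_add -pw -catA => /reads_cat[z rz1].
set w3 := mkseq _ _ => rz23.
have [u rz2 _] := iffLR (reads_cat w2 w3 z z') rz23.
have ez : z \in delayed_estimate w1 w2 by apply/estP; exists z0, u.
apply/eqP/cards1P; exists z; apply/setP => y; rewrite in_set1.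
apply/idP/eqP => [/estP[y0 [y' [iy ry1 ry2]]]|-> //].
apply: contrapT => /eqP neq.
have big_gt0 : 0 < big by rewrite /big !muln_gt0 !andbb; apply/card_gt0P; exists z.
(* The run through [z] serves twice: as the competitor of the run through [y], and as the run that
   continues along [sigma]. *)
have : (y0, z0, z0) \notin remote by apply: far.
case/negP.
have amb : (y, z, z) \in ambiguous.
  (* Since [w2] may be longer than [K], its surplus joins [w3] in the word that shows liveness. *)
  move: ry2 rz23; rewrite -(cat_take_drop K w2) -catA.
  move=> /reads_cat[y1 ry1' _] /reads_cat[z1 rz1' rz2'].
  apply/ambiguousP; split=> //; exists (take K w2), y1, z1, z1.
  split=> //; first by rewrite size_take; case: ltnP => //; lia.
  apply/diag_iter_pre; move: rz2'.
  rewrite -(cat_take_drop big (drop K w2 ++ w3)) => /reads_cat[v rv _].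
  exists (take big (drop K w2 ++ w3)), v; split=> //.
  rewrite size_take size_cat size_mkseq; case: ltnP => //; lia.
have : (y0, z0, z0) \in iter (size w1) pre ambiguous.
  apply/iter_preP; first by left; apply: leq_trans big_gt0 le1.
  by exists w1, (y, z, z).
(* The first [big] letters of [w1] account for the iterations in [remote], the others lead from an
   ancestor to the ambiguous triple. *)
rewrite -(subnKC le1) iterD; apply/subsetP/iter_preS/subsetP => q qj.
by apply/ancestorsP; exists (size w1 - big).
Qed.

End Automaton.

(** * Tables over triples of states *)

Definition truth s e := eval s e != 0.

(* Nonzero means true, and the subtraction is truncated. *)
Definition And e1 e2 := Minus (Cst 1) (Plus (Minus (Cst 1) e1) (Minus (Cst 1) e2)).
Definition Neq e1 e2 := Plus (Minus e1 e2) (Minus e2 e1).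
Definition Eq e1 e2 := Minus (Cst 1) (Neq e1 e2).

Lemma truth_Plus s e1 e2 : truth s (Plus e1 e2) = truth s e1 || truth s e2.
Proof. by rewrite /truth /= addn_eq0 negb_and. Qed.

Lemma truth_And s e1 e2 : truth s (And e1 e2) = truth s e1 && truth s e2.
Proof. by rewrite /truth /=; lia. Qed.

Lemma truth_Neq s e1 e2 : truth s (Neq e1 e2) = (eval s e1 != eval s e2).
Proof. by rewrite /truth /=; lia. Qed.

Lemma truth_Eq s e1 e2 : truth s (Eq e1 e2) = (eval s e1 == eval s e2).
Proof. by rewrite /truth /=; lia. Qed.

Lemma truth_Sum s v b e :
  truth s (Sum v b e) <-> exists2 i, i < vars s b & truth (setv s v i) e.
Proof.
rewrite /truth /= sum_nat_eq0 negb_forall; split=> [/existsP[i ti]|[i lti ti]].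
  by exists i.
by apply/existsP; exists (Ordinal lti).
Qed.

(** A formula that does not read [a] keeps its value while the table [a] is being overwritten. *)
Fixpoint noread a e :=
  match e with
  | Var _ | Cst _ => true
  | Plus e1 e2 | Minus e1 e2 => noread a e1 && noread a e2
  | Get b e1 => (b != a) && noread a e1
  | Sum _ _ e1 => noread a e1
  end.

Lemma eval_noread a e s1 s2 : noread a e -> vars s1 = vars s2 ->
  (forall b, b != a -> arrs s1 b = arrs s2 b) -> eval s1 e = eval s2 e.
Proof.
elim: e s1 s2 => [v|n|e1 IH1 e2 IH2|e1 IH1 e2 IH2|b e IH|v b e IH] s1 s2 /=.
- by move=> _ ->.
- by [].
- by case/andP=> n1 n2 Ev Ea; rewrite (IH1 _ s2) ?(IH2 _ s2).
- by case/andP=> n1 n2 Ev Ea; rewrite (IH1 _ s2) ?(IH2 _ s2).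
- by case/andP=> nb ne Ev Ea; rewrite Ea // (IH _ s2).
move=> ne Ev Ea; rewrite Ev; apply: eq_bigr => i _.
by apply: IH => //=; rewrite Ev.
Qed.

(* Variable 0 holds the number [n] of states, and the entry [(x, y, z)] of an
   [n * n * n] table is stored at index [n * (n * x + y) + z]. *)
Definition offset n x y z := n * (n * x + y) + z.

(** Multiplication by the number of states is a sum of that many equal terms; variable 30 is
    reserved as its dummy index. *)
Definition Index e1 e2 e3 := Plus (Sum 30 0 (Plus (Sum 30 0 e1) e2)) e3.

Definition fresh30 e := forall s i, eval (setv s 30 i) e = eval s e.

Lemma eval_Index s e1 e2 e3 : fresh30 e1 -> fresh30 e2 ->
  eval s (Index e1 e2 e3) = offset (vars s 0) (eval s e1) (eval s e2) (eval s e3).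
Proof.
move=> f1 f2; rewrite /= /offset; congr (_ + _).
under eq_bigr => i _.
  under eq_bigr => j _ do rewrite f1 f1.
  rewrite f2 sum_nat_const card_ord; over.
by rewrite sum_nat_const card_ord.
Qed.

Definition Table a e1 e2 e3 := Get a (Index e1 e2 e3).

Definition fill a e :=
  For 7 0 (For 8 0 (For 9 0 (Put a (Index (Var 7) (Var 8) (Var 9)) e))).

Definition setxyz s x y z := setv (setv (setv s 7 x) 8 y) 9 z.

Section Fill.

Variables (a : array) (s : store) (val : nat -> nat -> nat -> nat).

Let n := vars s 0.
Let value j := val (j %/ n %/ n) (j %/ n %% n) (j %% n).

Lemma value_offset x y z : y < n -> z < n -> value (offset n x y z) = val x y z.
Proof.
move=> lty ltz; rewrite /value /offset.
have quo u v : v < n -> (n * u + v) %/ n = u.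
  by move=> ltv; rewrite mulnC divnMDl ?divn_small ?addn0 //; lia.
have rem u v : v < n -> (n * u + v) %% n = v.
  by move=> ltv; rewrite mulnC modnMDl modn_small.
by rewrite !quo // !rem.
Qed.

Definition same_but s1 := forall b, b != a -> arrs s1 b = arrs s b.

(** [D] collects the indices that are written. Correct entries stay correct even if written again,
    so the order of writing is irrelevant. *)
Definition fills (f : store -> store) (D : nat -> Prop) s1 :=
  [/\ same_but (f s1), vars (f s1) = vars s1,
      forall j, arrs s1 a j = value j -> arrs (f s1) a j = value j &
      forall j, D j -> arrs (f s1) a j = value j].

Lemma fills_For v c (D : nat -> nat -> Prop) s1 :
  same_but s1 -> vars s1 0 = n ->
  (forall i s2, i < n -> same_but s2 -> vars s2 = vars (setv s1 v i) ->
     fills (sem c) (D i) s2) ->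
  fills (sem (For v 0 c)) (fun j => exists2 i, i < n & D i j) s1.
Proof.
move=> sim1 n1 step; rewrite /fills /= n1; set f := fun _ _ => _.
have main k : k <= n -> [/\ same_but (iteri k f s1),
    forall i, vars (setv (iteri k f s1) v i) = vars (setv s1 v i),
    forall j, arrs s1 a j = value j -> arrs (iteri k f s1) a j = value j &
    forall i j, i < k -> D i j -> arrs (iteri k f s1) a j = value j].
  elim: k => // k IH ltk; have [sim eqv keep written] := IH (ltnW ltk).
  have [//|sim' eqv' keep' written'] := step k (setv (iteri k f s1) v k) ltk _ (eqv k).
  rewrite iteriS -/(f k _) /f; split=> //.
  - move=> i; apply: funext => u /=; rewrite eqv' /=.
    by have := congr1 (fun g => g u) (eqv i); rewrite /=; case: eqP.
  - by move=> j ej; apply/keep'/keep.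
  - move=> i j; rewrite ltnS leq_eqVlt => /orP[/eqP->|lti] Dij; first exact: written'.
    by apply: keep'; apply: written Dij.
have [//|sim eqv keep written] := main n; split=> //=.
- apply: funext => u /=; have := congr1 (fun g => g u) (eqv (vars s1 v)).
  by rewrite /=; case: eqP => [->|].
- by move=> j [i lti Dij]; apply: written Dij.
Qed.

Lemma sem_fill e :
  (forall x y z s1, x < n -> y < n -> z < n -> same_but s1 ->
     vars s1 = vars (setxyz s x y z) -> eval s1 e = val x y z) ->
  [/\ vars (sem (fill a e) s) = vars s, same_but (sem (fill a e) s) &
      forall x y z, x < n -> y < n -> z < n ->
        arrs (sem (fill a e) s) a (offset n x y z) = val x y z].
Proof.
move=> He.
have [|//||sim eqv _ written] := @fills_For 7 (For 8 0 (For 9 0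
    (Put a (Index (Var 7) (Var 8) (Var 9)) e)))
    (fun x j => exists2 y, y < n & exists2 z, z < n & j = offset n x y z) s.
- by [].
- move=> x s1 ltx sim1 E1; apply: fills_For => //; first by rewrite E1.
  move=> y s2 lty sim2 E2; apply: fills_For => //; first by rewrite E2 /= E1.
  move=> z s3 ltz sim3 E3.
  have E : vars s3 = vars (setxyz s x y z) by rewrite E3 /= E2 /= E1.
  have Ev : eval s3 e = value (offset n x y z) by rewrite value_offset //; apply: He.
  have Ei : eval s3 (Index (Var 7) (Var 8) (Var 9)) = offset n x y z.
    by rewrite eval_Index //= E.
  have Es : sem (Put a (Index (Var 7) (Var 8) (Var 9)) e) s3
      = seta s3 a (offset n x y z) (value (offset n x y z)).
    by rewrite -{1}Ei -Ev.
  rewrite /fills Es; split=> //=.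
  + by move=> b nb; rewrite -sim3 //; apply: funext => j /=; rewrite (negPf nb).
  + by move=> j ej; case: andP => // -[_ /eqP->].
  + by move=> j ->; rewrite !eqxx.
split=> // x y z ltx lty ltz; rewrite written ?value_offset //.
by exists x => //; exists y => //; exists z.
Qed.

End Fill.

(* The events of the transitions are only used as indices into the table [LAB] of
   labels, which is coded as in [code_label]. *)
Notation INIT := (@Ordinal 14 0 isT).
Notation SRC := (@Ordinal 14 1 isT).
Notation EVT := (@Ordinal 14 2 isT).
Notation DST := (@Ordinal 14 3 isT).
Notation LAB := (@Ordinal 14 4 isT).
Notation EPS := (@Ordinal 14 5 isT).
Notation TAB := (@Ordinal 14 6 isT).
Notation TMP := (@Ordinal 14 7 isT).

(** The detour through [TMP] lets [e] read the old contents of [a] throughout. *)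
Definition update a e :=
  Seq (fill TMP e) (fill a (Table TMP (Var 7) (Var 8) (Var 9))).

Lemma sem_update a e s : noread TMP e -> a != TMP ->
  [/\ vars (sem (update a e) s) = vars s,
      forall b, b != a -> b != TMP -> arrs (sem (update a e) s) b = arrs s b &
      forall x y z, x < vars s 0 -> y < vars s 0 -> z < vars s 0 ->
        arrs (sem (update a e) s) a (offset (vars s 0) x y z) =
        eval (setxyz s x y z) e].
Proof.
move=> ne na; rewrite -[sem _ s]/(sem (fill a (Table TMP (Var 7) (Var 8) (Var 9)))
  (sem (fill TMP e) s)).
have [|vE aE tE] := @sem_fill TMP s (fun x y z => eval (setxyz s x y z) e) e.
  by move=> x y z s1 _ _ _ sim1 E1; apply: eval_noread ne E1 _.
move: (sem (fill TMP e) s) vE aE tE => s1 vE aE tE.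
have [|vE' aE' tE'] := @sem_fill a s1 (fun x y z => eval (setxyz s x y z) e)
  (Table TMP (Var 7) (Var 8) (Var 9)).
  move=> x y z s2; rewrite vE => ltx lty ltz sim2 E2.
  rewrite -[LHS]/(arrs s2 TMP (eval s2 (Index (Var 7) (Var 8) (Var 9)))).
  by rewrite eval_Index //= E2 /= sim2 1?eq_sym // vE tE.
split=> [|b nb nT|x y z ltx lty ltz]; first by rewrite vE' vE.
  by rewrite aE' // aE.
by rewrite -vE tE' // vE.
Qed.

(** * The saturation procedure *)

Lemma truth_Table s a e1 e2 e3 : fresh30 e1 -> fresh30 e2 ->
  truth s (Table a e1 e2 e3) =
  (arrs s a (offset (vars s 0) (eval s e1) (eval s e2) (eval s e3)) != 0).
Proof. by move=> f1 f2; rewrite -eval_Index. Qed.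

(* Variables 0 to 5 hold the numbers of states, events and letters, the delay [K],
   and the numbers of initial states and of transitions; variable 6 is the input
   buffer.  The table [EPS] ignores its third coordinate. *)
Definition repeat3 c := For 20 0 (For 21 0 (For 22 0 c)).

Definition silent_init := Eq (Var 7) (Var 8).

(** One round prepends a silent transition to the pairs already known. *)
Definition silent_step :=
  Plus (Table EPS (Var 7) (Var 8) (Var 9))
       (Sum 10 5
         (And (And (Eq (Get LAB (Get EVT (Var 10))) (Cst 0))
                   (Eq (Get SRC (Var 10)) (Var 7)))
              (Table EPS (Get DST (Var 10)) (Var 8) (Var 9)))).

(** The 1 is the shift in the coding of labels, where 0 is the empty word. The third coordinates
    given to [EPS] are arbitrary. *)
Definition Reads a x y :=
  Sum 10 5
    (And (And (Eq (Get LAB (Get EVT (Var 10))) (Plus (Var a) (Cst 1)))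
              (Table EPS (Var x) (Get SRC (Var 10)) (Var x)))
         (Table EPS (Get DST (Var 10)) (Var y) (Var y))).

Definition Pre :=
  Sum 11 0 (Sum 12 0 (Sum 13 0
    (And (Table TAB (Var 11) (Var 12) (Var 13))
         (Sum 14 2 (And (And (Reads 14 7 11) (Reads 14 8 12)) (Reads 14 9 13)))))).

(** Once [EPS] holds the silent closure, [TAB] holds in turn: all triples, [live], the triples with
    a live third component, their [K]-fold preimage, [ambiguous], [ancestors] and [remote]. *)
Definition saturate :=
  Seq (update EPS silent_init) (
  Seq (repeat3 (update EPS silent_step)) (
  Seq (update TAB (Cst 1)) (
  Seq (repeat3 (update TAB Pre)) (
  Seq (update TAB (Table TAB (Var 9) (Var 9) (Var 9))) (
  Seq (For 20 3 (update TAB Pre)) (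
  Seq (update TAB (And (Table TAB (Var 7) (Var 8) (Var 9))
                       (Neq (Var 7) (Var 8)))) (
  Seq (repeat3 (update TAB (Plus (Table TAB (Var 7) (Var 8) (Var 9)) Pre)))
      (repeat3 (update TAB Pre))))))))).

Definition answer :=
  Sum 7 4 (Sum 8 4 (Sum 9 4
    (Table TAB (Get INIT (Var 7)) (Get INIT (Var 8)) (Get INIT (Var 9))))).

(** * Correctness of the saturation *)

Section Correctness.

Variables (A : fsa) (K : nat).

Notation rank x := (val (enum_rank x)).
Notation n := #|state A|.

Record loaded (s : store) : Prop := Loaded {
  loaded_state : vars s 0 = n;
  loaded_letter : vars s 2 = #|letter A|;
  loaded_K : vars s 3 = K;
  loaded_init : vars s 4 = #|init A|;
  loaded_trans : vars s 5 = #|trans A|;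
  init_sound : forall i, i < #|init A| ->
    exists2 x, x \in init A & arrs s INIT i = rank x;
  init_complete : forall x, x \in init A ->
    exists2 i, i < #|init A| & arrs s INIT i = rank x;
  trans_sound : forall i, i < #|trans A| -> exists2 e, e \in trans A &
    [/\ arrs s SRC i = rank e.1.1, arrs s LAB (arrs s EVT i) = code_label e.1.2 &
        arrs s DST i = rank e.2];
  trans_complete : forall e, e \in trans A -> exists2 i, i < #|trans A| &
    [/\ arrs s SRC i = rank e.1.1, arrs s LAB (arrs s EVT i) = code_label e.1.2 &
        arrs s DST i = rank e.2]
}.

(** The instance occupies variables 0 to 5 and the arrays from [INIT] to [LAB]; the saturation works
    with later ones. *)
Lemma loaded_eq s s1 : loaded s -> (forall u, u < 6 -> vars s1 u = vars s u) ->
  (forall b : array, b < 5 -> arrs s1 b = arrs s b) -> loaded s1.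
Proof. by move=> [? ? ? ? ? ? ? ? ?] Ev Ea; split; rewrite ?Ev ?Ea. Qed.

Lemma loaded_setv s v x : 5 < v -> loaded s -> loaded (setv s v x).
Proof.
by move=> ltv ld; apply: loaded_eq ld _ _ => // u ltu /=; case: eqP => // Eu; lia.
Qed.

Definition represents s a (S : {set triple A}) := forall x y z,
  (arrs s a (offset n (rank x) (rank y) (rank z)) != 0) = ((x, y, z) \in S).

Lemma ltn_rank (T : finType) (x : T) : rank x < #|T|.
Proof. exact: (ltn_ord (enum_rank x)). Qed.

Lemma ex_rank (T : finType) (Q : nat -> Prop) :
  (exists2 i, i < #|T| & Q i) <-> exists x : T, Q (rank x).
Proof.
split=> [[i lti Qi]|[x Qx]]; last by exists (rank x); rewrite ?ltn_rank.
by exists (enum_val (Ordinal lti)); rewrite enum_valK.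
Qed.

Lemma ex_trans s (Q : nat -> nat -> nat -> Prop) : loaded s ->
  (exists2 i, i < vars s 5 & Q (arrs s SRC i) (arrs s LAB (arrs s EVT i)) (arrs s DST i))
  <-> exists2 e, e \in trans A & Q (rank e.1.1) (code_label e.1.2) (rank e.2).
Proof.
move=> ld; rewrite loaded_trans //; split=> [[i lti]|[e te Qe]].
  by have [e te [-> -> ->]] := trans_sound ld lti; exists e.
by have [i lti [E1 E2 E3]] := trans_complete ld te; exists i => //; rewrite E1 E2 E3.
Qed.

Lemma update_represents s a e (S : {set triple A}) :
  loaded s -> noread TMP e -> a != TMP -> 4 < a ->
  (forall x y z, truth (setxyz s (rank x) (rank y) (rank z)) e = ((x, y, z) \in S)) ->
  let s1 := sem (update a e) s in
  [/\ loaded s1, represents s1 a S &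
      forall b, b != a -> b != TMP -> arrs s1 b = arrs s b].
Proof.
move=> ld ne na lta He s1; have [vE aE tE] := sem_update s ne na.
rewrite -/s1 in vE aE tE; split=> //.
- apply: loaded_eq ld _ _ => [u _|b ltb]; first by rewrite vE.
  by apply: aE; apply/eqP => Eb; move: ltb lta; rewrite Eb => /=; lia.
- move=> x y z; have := tE (rank x) (rank y) (rank z).
  by rewrite (loaded_state ld) => ->; rewrite ?ltn_rank // -He.
Qed.

Section Iteration.

Variables (Inv : {set triple A} -> store -> Prop) (f : {set triple A} -> {set triple A}).
Variable c : cmd.
Hypothesis Inv_setv : forall S s v x, 5 < v -> Inv S s -> Inv S (setv s v x).

Lemma sem_For_iter v b S s : 5 < v ->
  (forall S s, Inv S s -> Inv (f S) (sem c s)) ->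
  Inv S s -> Inv (iter (vars s b) f S) (sem (For v b c) s).
Proof.
move=> ltv step IS; apply: Inv_setv => //.
by elim: (vars s b) => //= k IH; apply/step/Inv_setv.
Qed.

End Iteration.

(** Loop bounds are variables, so that the cube of the number of states is reached by nesting three
    loops. *)
Lemma sem_repeat3_iter (Inv : {set triple A} -> store -> Prop) f c S s :
  (forall S s v x, 5 < v -> Inv S s -> Inv S (setv s v x)) ->
  (forall S s, Inv S s -> vars s 0 = n) ->
  (forall S s, Inv S s -> Inv (f S) (sem c s)) ->
  Inv S s -> Inv (iter (big A) f S) (sem (repeat3 c) s).
Proof.
move=> Inv_setv Inv0 step IS.
have E : iter (big A) f =1 iter n (iter n (iter n f)).
  by move=> S1; rewrite /big -mulnA iterM; apply: eq_iter => S2; rewrite iterM.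
rewrite E -{1}(Inv0 _ _ IS); apply: sem_For_iter => // {IS}S {}s IS.
rewrite -{1}(Inv0 _ _ IS); apply: sem_For_iter => // {IS}S {}s IS.
by rewrite -{1}(Inv0 _ _ IS); apply: sem_For_iter.
Qed.

Definition silent_set := [set p : triple A | connect (@silent A) p.1.1 p.1.2].

Definition silent_pre (S : {set triple A}) : {set triple A} :=
  S :|: [set p : triple A | [exists u, silent p.1.1 u && ((u, p.1.2, p.2) \in S)]].

(** The iteration is stable after [big] rounds. A stable set that contains the diagonal absorbs a
    silent path step by step, starting from its end. *)
Lemma silent_setE :
  iter (big A) silent_pre [set p : triple A | p.1.1 == p.1.2] = silent_set.
Proof.
set E := iter _ _ _; apply/eqP; rewrite eqEsubset; apply/andP; split.
  rewrite /E; elim: (big A) => [|k IH].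
    by apply/subsetP => -[[x y] z]; rewrite !inE /= => /eqP->.
  apply/subsetP => -[[x y] z]; rewrite iterS inE => /orP[/(subsetP IH)//|].
  rewrite !inE /= => /existsP[u /andP[xu /(subsetP IH)]]; rewrite inE /=.
  exact/connect_trans/connect1.
have stable : silent_pre E = E.
  rewrite /E -iterS iter_incr_stable ?card_triple // => j.
  by rewrite iterS subsetUl.
have base z y : (y, y, z) \in E.
  rewrite /E; elim: (big A) => [|k IH]; first by rewrite inE.
  by rewrite iterS inE IH.
apply/subsetP => -[[x y] z]; rewrite inE /= => /connectP[p].
elim: p x => [|u p IH] x /=; first by move=> _ ->.
case/andP=> xu up Ey; rewrite -stable inE; apply/orP; right.
by rewrite inE; apply/existsP; exists u; rewrite xu IH.
Qed.

Lemma rank_inj (T : finType) (x y : T) : (rank x == rank y) = (x == y).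
Proof. by rewrite (inj_eq val_inj) (inj_eq enum_rank_inj). Qed.

Lemma truth_silent_step s S x y z : loaded s -> represents s EPS S ->
  truth (setxyz s (rank x) (rank y) (rank z)) silent_step =
  ((x, y, z) \in silent_pre S).
Proof.
move=> ld rS; rewrite truth_Plus truth_Table // in_setU.
rewrite -[vars _ 0]/(vars s 0) (loaded_state ld); congr (_ || _); first exact: rS.
(* The summand depends on its index only through the source, label and target stored there; [Q]
   isolates this dependence, so that [ex_trans] turns indices into transitions. *)
rewrite inE /=; pose Q a b c := [&& b == 0, a == rank x &
  arrs s EPS (offset n c (rank y) (rank z)) != 0].
have E i : truth (setv (setxyz s (rank x) (rank y) (rank z)) 10 i)
    (And (And (Eq (Get LAB (Get EVT (Var 10))) (Cst 0))
              (Eq (Get SRC (Var 10)) (Var 7)))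
         (Table EPS (Get DST (Var 10)) (Var 8) (Var 9))) =
    Q (arrs s SRC i) (arrs s LAB (arrs s EVT i)) (arrs s DST i).
  by rewrite !truth_And !truth_Eq truth_Table //= (loaded_state ld) -andbA.
apply/idP/existsP.
  case/truth_Sum=> i lti; rewrite E => Qi.
  have [[[u t] v] te] : exists2 e, e \in trans A &
      Q (rank e.1.1) (code_label e.1.2) (rank e.2).
    by apply/(@ex_trans s Q ld); exists i.
  rewrite /Q /= rank_inj (rS v y z) => /and3P[lt /eqP Eu vS].
  exists v; rewrite vS andbT; apply/existsP; exists t; rewrite -Eu te.
  by move: lt; rewrite /code_label; case: (label t).
move=> [v /andP[/existsP[t /andP[te /eqP lt]] vS]]; apply/truth_Sum.
have [i lti Qi] : exists2 i, i < vars s 5 &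
    Q (arrs s SRC i) (arrs s LAB (arrs s EVT i)) (arrs s DST i).
  apply/(@ex_trans s Q ld); exists (x, t, v) => //.
  by rewrite /Q /= rank_inj eqxx (rS v y z) vS /code_label lt.
by exists i => //; rewrite E.
Qed.

Lemma represents_silent s (x y z : state A) : represents s EPS silent_set ->
  (arrs s EPS (offset n (rank x) (rank y) (rank z)) != 0) <-> reads [::] x y.
Proof. by move=> ->; rewrite inE /=; split=> /reads_silent. Qed.

(** The inequalities keep the arguments from being captured by the bound variables 10 and 30. *)
Lemma truth_Reads s a x y (l : letter A) (u v : state A) :
  a != 10 -> x != 10 -> y != 10 -> x != 30 -> y != 30 ->
  loaded s -> represents s EPS silent_set ->
  vars s a = rank l -> vars s x = rank u -> vars s y = rank v ->
  truth s (Reads a x y) <-> reads [:: l] u v.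
Proof.
move=> na nx ny nx' ny' ld rE Ea Ex Ey; rewrite reads1.
pose Q b c d := [&& c == (rank l).+1,
  arrs s EPS (offset n (rank u) b (rank u)) != 0 &
  arrs s EPS (offset n d (rank v) (rank v)) != 0].
have E i : truth (setv s 10 i)
    (And (And (Eq (Get LAB (Get EVT (Var 10))) (Plus (Var a) (Cst 1)))
              (Table EPS (Var x) (Get SRC (Var 10)) (Var x)))
         (Table EPS (Get DST (Var 10)) (Var y) (Var y))) =
    Q (arrs s SRC i) (arrs s LAB (arrs s EVT i)) (arrs s DST i).
  have f w : w != 30 -> fresh30 (Var w) by move=> /negPf nw s' j /=; rewrite nw.
  rewrite !truth_And truth_Eq !truth_Table //=; try exact: f.
  rewrite (negPf na) (negPf nx) (negPf ny) Ea Ex Ey (loaded_state ld).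
  by rewrite addn1 -andbA.
rewrite truth_Sum; transitivity (exists2 e, e \in trans A &
    Q (rank e.1.1) (code_label e.1.2) (rank e.2)).
  rewrite -(@ex_trans s Q ld); split=> -[i lti]; rewrite ?E => Qi; exists i => //.
  by rewrite E.
have silentP x1 y1 z1 := represents_silent x1 y1 z1 rE.
split=> [[e te /and3P[lt /silentP r1 /silentP r2]]|].
  exists e; split=> //; move: lt; rewrite /code_label.
  by case: (label e.1.2) => // b; rewrite eqSS rank_inj => /eqP->.
move=> [e [te lt r1 r2]]; exists e => //; apply/and3P; split.
- by rewrite /code_label lt.
- exact/silentP.
- exact/silentP.
Qed.

Lemma truth_Sum_rank (T : finType) s v b e : vars s b = #|T| ->
  truth s (Sum v b e) <-> exists x : T, truth (setv s v (rank x)) e.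
Proof. by move=> Eb; rewrite truth_Sum Eb; apply: ex_rank. Qed.

Lemma truth_Pre s S x y z : loaded s -> represents s EPS silent_set ->
  represents s TAB S ->
  truth (setxyz s (rank x) (rank y) (rank z)) Pre = ((x, y, z) \in pre S).
Proof.
move=> ld rE rS; have [n0 n2 _ _ _ _ _ _ _] := ld.
set s1 := setxyz s (rank x) (rank y) (rank z).
pose s2 (u : state A) := setv s1 11 (rank u).
pose s3 (u v : state A) := setv (s2 u) 12 (rank v).
pose s4 (u v w : state A) := setv (s3 u v) 13 (rank w).
have X1 e := @truth_Sum_rank (state A) s1 11 0 e n0.
have X2 u e := @truth_Sum_rank (state A) (s2 u) 12 0 e n0.
have X3 u v e := @truth_Sum_rank (state A) (s3 u v) 13 0 e n0.
have X4 u v w e := @truth_Sum_rank (letter A) (s4 u v w) 14 2 e n2.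
have E (u v w : state A) (l : letter A) :
    truth (setv (s4 u v w) 14 (rank l))
      (And (And (Reads 14 7 11) (Reads 14 8 12)) (Reads 14 9 13))
    <-> treads [:: l] (x, y, z) (u, v, w).
  have ld5 : loaded (setv (s4 u v w) 14 (rank l)) by do !apply: loaded_setv => //.
  have R1 := @truth_Reads _ 14 7 11 l x u isT isT isT isT isT ld5 rE erefl erefl erefl.
  have R2 := @truth_Reads _ 14 8 12 l y v isT isT isT isT isT ld5 rE erefl erefl erefl.
  have R3 := @truth_Reads _ 14 9 13 l z w isT isT isT isT isT ld5 rE erefl erefl erefl.
  rewrite !truth_And; split=> [/andP[/andP[/R1 r1 /R2 r2] /R3 r3]|]; first by split.
  by case=> /R1-> /R2-> /R3->.
have T (u v w : state A) : truth (s4 u v w)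
    (And (Table TAB (Var 11) (Var 12) (Var 13))
         (Sum 14 2 (And (And (Reads 14 7 11) (Reads 14 8 12)) (Reads 14 9 13))))
    <-> (u, v, w) \in S /\ exists l, treads [:: l] (x, y, z) (u, v, w).
  rewrite truth_And truth_Table // -[vars _ 0]/(vars s 0) n0 (rS u v w).
  split=> [/andP[uS /X4[l /E r]]|[-> [l /E r]]]; first by split=> //; exists l.
  by apply/X4; exists l.
apply/idP/idP => [/X1[u /X2[v /X3[w /T[uS ex]]]]|/preP[[[u v] w] uS ex]].
  by apply/preP; exists (u, v, w).
by apply/X1; exists u; apply/X2; exists v; apply/X3; exists w; apply/T.
Qed.

Lemma truth_TAB s S x y z : loaded s -> represents s TAB S ->
  truth (setxyz s (rank x) (rank y) (rank z)) (Table TAB (Var 7) (Var 8) (Var 9))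
  = ((x, y, z) \in S).
Proof. by move=> ld rS; rewrite truth_Table //= (loaded_state ld) -rS. Qed.

Definition tables (S : {set triple A}) s :=
  [/\ loaded s, represents s EPS silent_set & represents s TAB S].

Lemma tables_setv S s v x : 5 < v -> tables S s -> tables S (setv s v x).
Proof. by move=> ltv [ld rE rS]; split=> //; apply: loaded_setv. Qed.

Lemma tables_update (S S1 : {set triple A}) s e : tables S s -> noread TMP e ->
  (forall x y z, truth (setxyz s (rank x) (rank y) (rank z)) e = ((x, y, z) \in S1)) ->
  tables S1 (sem (update TAB e) s).
Proof.
move=> [ld rE _] ne He.
have [ld1 r1 aE] := update_represents ld ne (isT : TAB != TMP) (isT : 4 < TAB) He.
by split=> // x y z; rewrite aE // rE.
Qed.

Definition leads c (P Q : store -> Prop) := forall s, P s -> Q (sem c s).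

Lemma leads_Seq Q c1 c2 (P R : store -> Prop) :
  leads c1 P Q -> leads c2 Q R -> leads (Seq c1 c2) P R.
Proof. by move=> h1 h2 s Ps; apply/h2/h1. Qed.

Definition closing S s := loaded s /\ represents s EPS S.

Lemma closing_setv S s v x : 5 < v -> closing S s -> closing S (setv s v x).
Proof. by move=> ltv [ld rE]; split=> //; apply: loaded_setv. Qed.

Lemma sem_saturate : leads saturate loaded (tables (remote A K)).
Proof.
have K3 S s : tables S s -> vars s 3 = K by case=> ld _ _; apply: loaded_K.
have n0 S s : tables S s -> vars s 0 = n by case=> ld _ _; apply: loaded_state.
have step S : leads (update TAB Pre) (tables S) (tables (pre S)).
  move=> s T; apply: (tables_update T) => // x y z.
  by have [ld rE rS] := T; apply: truth_Pre.
apply: (leads_Seq (Q := closing [set p : triple A | p.1.1 == p.1.2])).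
  move=> s ld.
  have [] := @update_represents s EPS silent_init [set p : triple A | p.1.1 == p.1.2]
    ld isT isT isT => // x y z.
  by rewrite truth_Eq /= rank_inj inE.
apply: (leads_Seq (Q := closing silent_set)).
  rewrite -silent_setE; move=> s; apply: (sem_repeat3_iter closing_setv).
    by move=> S s1 [ld _]; apply: loaded_state.
  move=> S s1 [ld rS].
  have [] := @update_represents s1 EPS silent_step (silent_pre S) ld isT isT isT => //.
  by move=> x y z; apply: truth_silent_step.
apply: (leads_Seq (Q := tables setT)).
  move=> s [ld rE].
  have [ld1 rS1 aE1] := @update_represents s TAB (Cst 1) setT ld isT isT isT
    (fun x y z => esym (in_setT (x, y, z))).
  by split=> // x y z; rewrite aE1 // rE.
apply: (leads_Seq (Q := tables (live A))).
  by move=> s; apply: (sem_repeat3_iter tables_setv n0 step).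
apply: (leads_Seq (Q := tables [set p : triple A | diag p.2 \in live A])).
  move=> s T; apply: (tables_update T) => // x y z; have [ld _ rS] := T.
  by rewrite truth_Table //= (loaded_state ld) rS inE.
apply: (@leads_Seq (tables (iter K (@pre A)
    [set p : triple A | diag p.2 \in live A]))).
  move=> s T; rewrite -{1}(K3 _ _ T).
  exact: (@sem_For_iter _ _ _ tables_setv 20 3 _ s isT step T).
apply: (leads_Seq (Q := tables (ambiguous A K))).
  move=> s T; apply: (tables_update T) => // x y z; have [ld _ rS] := T.
  by rewrite truth_And (truth_TAB x y z ld rS) truth_Neq /= rank_inj !inE.
apply: (leads_Seq (Q := tables (ancestors A K))) => s; last first.
  exact: (sem_repeat3_iter tables_setv n0 step).
apply: (sem_repeat3_iter tables_setv n0) => S {}s T.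
apply: (tables_update T) => // x y z; have [ld rE rS] := T.
by rewrite truth_Plus (truth_TAB x y z ld rS) (truth_Pre x y z ld rE rS) in_setU.
Qed.

Lemma truth_answer s S : tables S s ->
  truth s answer <-> exists p : triple A,
    [/\ p.1.1 \in init A, p.1.2 \in init A, p.2 \in init A & p \in S].
Proof.
move=> [ld _ rS]; have [n0 _ _ n4 _ i_sound i_complete _ _] := ld.
have E i j k : truth (setxyz s i j k)
    (Table TAB (Get INIT (Var 7)) (Get INIT (Var 8)) (Get INIT (Var 9))) =
  (arrs s TAB (offset n (arrs s INIT i) (arrs s INIT j) (arrs s INIT k)) != 0).
  by rewrite truth_Table //= n0.
split.
  case/truth_Sum=> i lti /truth_Sum[j ltj /truth_Sum[k ltk]]; rewrite [truth _ _]E.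
  rewrite /= !n4 in lti ltj ltk.
  have [x xi ->] := i_sound _ lti; have [y yi ->] := i_sound _ ltj.
  have [z zi ->] := i_sound _ ltk.
  by rewrite rS => pS; exists (x, y, z).
move=> [[[x y] z] [/= xi yi zi pS]].
have [i lti Ei] := i_complete _ xi; have [j ltj Ej] := i_complete _ yi.
have [k ltk Ek] := i_complete _ zi.
apply/truth_Sum; exists i; rewrite ?n4 //; apply/truth_Sum; exists j; rewrite /= ?n4 //.
apply/truth_Sum; exists k; rewrite /= ?n4 //.
by rewrite [truth _ _]E Ei Ej Ek rS.
Qed.

End Correctness.

(** * Reading the input *)

Definition store_next a := Seq (Input 6) (Put a (Var 7) (Var 6)).

Definition read_list a b := For 7 b (store_next a).

Definition read_triples b :=
  For 7 b (Seq (store_next SRC) (Seq (store_next EVT) (store_next DST))).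

Definition flat_triples (l : seq (nat * nat * nat)) :=
  flatten [seq [:: e.1.1; e.1.2; e.2] | e <- l].

Lemma sem_read_list a b s w r : b != 6 -> inp s = w ++ r -> vars s b = size w ->
  [/\ inp (sem (read_list a b) s) = r,
      forall u, u != 6 -> vars (sem (read_list a b) s) u = vars s u,
      forall i, i < size w -> arrs (sem (read_list a b) s) a i = nth 0 w i &
      forall c, c != a -> arrs (sem (read_list a b) s) c = arrs s c].
Proof.
move=> nb Ew Eb; rewrite [sem _ s]/= Eb; set f := fun _ _ => _.
(* Inside the loop variable 7 changes as well as the buffer 6; it is restored only on exit. *)
have main k : k <= size w -> [/\ inp (iteri k f s) = drop k w ++ r,
    forall u, u != 6 -> u != 7 -> vars (iteri k f s) u = vars s u,
    forall i, i < k -> arrs (iteri k f s) a i = nth 0 w i &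
    forall c, c != a -> arrs (iteri k f s) c = arrs s c].
  elim: k => [|k IH] ltk; first by rewrite drop0.
  have [Ei Ev Ea Ec] := IH (ltnW ltk).
  rewrite iteriS; move: (iteri k f s) Ei Ev Ea Ec => s1 Ei Ev Ea Ec.
  rewrite (drop_nth 0) // in Ei; split=> /=.
  - by rewrite Ei.
  - by move=> u n6 n7; rewrite (negPf n6) (negPf n7) Ev.
  - move=> i; rewrite eqxx Ei /=; case: eqP => [-> //|neq] lti.
    by apply: Ea; lia.
  by move=> c nc; apply: funext => i; rewrite (negPf nc) Ec.
have [Ei Ev Ea Ec] := main _ (leqnn _); split=> //=.
- by rewrite Ei drop_size.
- by move=> u n6; case: eqP => [-> //|/eqP n7]; apply: Ev.
Qed.

Lemma sem_read_triples b s l r : b != 6 -> inp s = flat_triples l ++ r ->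
  vars s b = size l ->
  let s1 := sem (read_triples b) s in
  [/\ inp s1 = r, forall u, u != 6 -> vars s1 u = vars s u,
      forall i, i < size l -> (arrs s1 SRC i, arrs s1 EVT i, arrs s1 DST i)
        = nth (0, 0, 0) l i &
      forall c, c != SRC -> c != EVT -> c != DST -> arrs s1 c = arrs s c].
Proof.
move=> nb Ew Eb; rewrite [sem _ s]/= Eb; set f := fun _ _ => _.
have main k : k <= size l -> [/\ inp (iteri k f s) = flat_triples (drop k l) ++ r,
    forall u, u != 6 -> u != 7 -> vars (iteri k f s) u = vars s u,
    forall i, i < k -> (arrs (iteri k f s) SRC i, arrs (iteri k f s) EVT i,
      arrs (iteri k f s) DST i) = nth (0, 0, 0) l i &
    forall c, c != SRC -> c != EVT -> c != DST -> arrs (iteri k f s) c = arrs s c].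
  elim: k => [|k IH] ltk; first by rewrite drop0.
  have [Ei Ev Ea Ec] := IH (ltnW ltk).
  rewrite iteriS; move: (iteri k f s) Ei Ev Ea Ec => s1 Ei Ev Ea Ec.
  rewrite (drop_nth (0, 0, 0)) // in Ei.
  case Ee: (nth _ l k) Ei => [[x y] z] Ei; rewrite /= in Ei.
  split=> /=.
  - by rewrite Ei.
  - by move=> u n6 n7; rewrite (negPf n6) (negPf n7) Ev.
  - move=> i; rewrite Ei /=; case: eqP => [-> //|neq] lti.
    by apply: Ea; lia.
  move=> c n1 n2 n3; apply: funext => i.
  by rewrite (negPf n1) (negPf n2) (negPf n3) Ec.
have [Ei Ev Ea Ec] := main _ (leqnn _); split=> //=.
- by rewrite Ei drop_size.
- by move=> u n6; case: eqP => [-> //|/eqP n7]; apply: Ev.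
Qed.

Definition load :=
  Seq (Input 0) (Seq (Input 1) (Seq (Input 2) (Seq (Input 3) (Seq (Input 4) (
  Seq (read_list INIT 4) (Seq (Input 5) (Seq (read_triples 5)
      (read_list LAB 1)))))))).

Lemma nth_enum_map (T : finType) (S : {pred T}) (g : T -> nat) i : i < #|S| ->
  exists2 x, x \in S & nth 0 [seq g x | x <- enum S] i = g x.
Proof.
move=> lti; have [x _] : exists x : T, true.
  by have /card_gt0P[x _] : 0 < #|S| by lia; exists x.
exists (nth x (enum S) i); first by rewrite -mem_enum mem_nth // -cardE.
by rewrite (nth_map x) // -cardE.
Qed.

Lemma sem_Seq c1 c2 s : sem (Seq c1 c2) s = sem c2 (sem c1 s).
Proof. by []. Qed.

Lemma loaded_load A K : loaded A K (sem load (start_store (code_instance A K))).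
Proof.
rewrite /load !sem_Seq; set s4 := sem (Input 4) _.
pose w1 := [seq val (enum_rank x) | x <- enum (init A)].
pose l := [seq (val (enum_rank e.1.1), val (enum_rank e.1.2), val (enum_rank e.2))
  | e <- enum (trans A)].
pose w2 := [seq code_label t | t <- enum (event A)].
have El : flatten [seq code_trans e | e <- enum (trans A)] = flat_triples l.
  by rewrite /flat_triples /l -map_comp.
have E4 : inp s4 = w1 ++ (#|trans A| :: flat_triples l ++ w2).
  by rewrite -El /s4 /code_instance /=.
have V4 : [/\ vars s4 0 = #|state A|, vars s4 1 = #|event A|,
    vars s4 2 = #|letter A|, vars s4 3 = K & vars s4 4 = #|init A|].
  by rewrite /s4 /code_instance /=.
move: s4 E4 V4 => s4 E4 [v40 v41 v42 v43 v44].
have [|i5 v5 a5 c5] := @sem_read_list INIT 4 s4 _ _ isT E4.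
  by rewrite v44 size_map -cardE.
move: (sem (read_list INIT 4) s4) i5 v5 a5 c5 => s5 i5 v5 a5 c5.
have E6 : inp (sem (Input 5) s5) = flat_triples l ++ w2 by rewrite /= i5.
have [|i7 v7 a7 c7] := @sem_read_triples 5 (sem (Input 5) s5) _ _ isT E6.
  by rewrite /= i5 size_map -cardE.
move: (sem (read_triples 5) _) i7 v7 a7 c7 => s7 i7 v7 a7 c7.
rewrite -[w2]cats0 in i7.
have [|_ v8 a8 c8] := @sem_read_list LAB 1 s7 _ _ isT i7.
  by rewrite v7 //= v5 //= v41 size_map -cardE.
move: (sem (read_list LAB 1) s7) v8 a8 c8 => s8 v8 a8 c8.
have label_ok (t : event A) : arrs s8 LAB (val (enum_rank t)) = code_label t.
  rewrite a8; last by rewrite size_map -cardE; apply: ltn_rank.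
  by rewrite /w2 (nth_map t) ?nth_enum_rank // -cardE; apply: ltn_rank.
have init_ok i : i < #|init A| -> arrs s8 INIT i = nth 0 w1 i.
  by move=> lti; rewrite c8 // c7 // a5 // size_map -cardE.
have trans_ok i : i < #|trans A| ->
    (arrs s8 SRC i, arrs s8 EVT i, arrs s8 DST i) = nth (0, 0, 0) l i.
  by move=> lti; rewrite !c8 // a7 // size_map -cardE.
split.
- by rewrite v8 // v7 //= v5.
- by rewrite v8 // v7 //= v5.
- by rewrite v8 // v7 //= v5.
- by rewrite v8 // v7 //= v5.
- by rewrite v8 // v7 //= i5.
- move=> i lti; have [x xi E] := nth_enum_map (fun x => val (enum_rank x)) lti.
  by exists x; rewrite // init_ok.
- move=> x xi; have lti : index x (enum (init A)) < #|init A|.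
    by rewrite cardE index_mem mem_enum.
  exists (index x (enum (init A))) => //; rewrite init_ok // /w1 (nth_map x) -?cardE //.
  by rewrite nth_index // mem_enum.
- move=> i lti.
  have [e0 _] : exists e, e \in trans A by apply/card_gt0P; lia.
  exists (nth e0 (enum (trans A)) i); first by rewrite -mem_enum mem_nth // -cardE.
  have := trans_ok i lti; rewrite /l (nth_map e0) -?cardE // => -[-> -> ->].
  by rewrite label_ok.
- move=> e te; have lti : index e (enum (trans A)) < #|trans A|.
    by rewrite cardE index_mem mem_enum.
  exists (index e (enum (trans A))) => //.
  have := trans_ok _ lti; rewrite /l (nth_map e) -?cardE // nth_index ?mem_enum //.
  by move=> -[-> -> ->]; rewrite label_ok.
Qed.

Lemma code_instance_bounded A K :
  all (leq^~ (fsa_size A + K)) (code_instance A K).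
Proof.
rewrite /code_instance /fsa_size.
set M := _ + K.
have ns : #|state A| <= M by rewrite /M; lia.
have nt : #|event A| <= M by rewrite /M; lia.
have nl : #|letter A| <= M by rewrite /M; lia.
have nr : #|trans A| <= M by rewrite /M; lia.
have nK : K <= M by rewrite /M; lia.
have ni : #|init A| <= M by apply: leq_trans (max_card _) ns.
have rs (x : state A) : val (enum_rank x) <= M.
  by apply: leq_trans (ltnW (ltn_rank x)) ns.
have rt (t : event A) : val (enum_rank t) <= M.
  by apply: leq_trans (ltnW (ltn_rank t)) nt.
rewrite !all_cat /= ns nt nl nK ni nr /= !all_map.
apply/and3P; split; apply/allP.
- by move=> x _; apply: rs.
- move=> y /flattenP[r /mapP[e _ ->]]; rewrite !inE.
  by case/or3P=> /eqP->.
- move=> t _ /=; rewrite /code_label; case: (label t) => // a.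
  by apply: leq_trans (ltn_rank a) nl.
Qed.

(** * The decision procedure *)

Local Open Scope ring_scope.

Theorem theorem1 :
  exists (P : program) (p : {poly nat}),
    forall (A : fsa) (K : nat),
      exists b : bool,
        run P p.[(fsa_size A + K)%N] (start (code_instance A K)) = Some b /\
        (b = true <-> omega_delayed_strongly_detectable A K).
Proof.
have [p runP] := run_decider (Seq load saturate) answer.
exists (decider (Seq load saturate) answer), p => A K; eexists; split.
  exact/runP/code_instance_bounded.
rewrite detectableP sem_Seq.
move: (sem saturate _) (sem_saturate (loaded_load A K)) => s T.
rewrite -[_ == _]negbK -/(truth _ _); split.
  move=> /negP no p0 i1 i2 i3; apply/negP => p0r; apply: no.
  by apply/(truth_answer T); exists p0.
move=> far; apply/negP => /(truth_answer T)[p0 [i1 i2 i3 p0r]].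
by move: p0r; apply/negP/far.
Qed.
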